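(* Assume that, for almost every realization of $\mathcal N$, the clan of ancestors $\mathcal A^\varphi$ is finite for every $\varphi\in\Gamma\times\mathbb{R}\times\mathbb{R}^+$. Then for every fixed $t\in\mathbb{R}$ and $\gamma\in\Gamma$, $\lim_{\Lambda\nearrow\mathbb{Z}^d}\eta^\Lambda_t(\gamma)=\eta_t(\gamma)$ almost surely. In particular, as $\Lambda\nearrow\mathbb{Z}^d$, $G_\Lambda$ converges weakly to $\mu$, the (time-independent) law of $\eta_t$.
   Context: Fix $\alpha>0$ and a strictly convex potential $V:\mathbb{Z}^d\to\mathbb{R}^+\cup\{+\infty\}$ with $V(\vec0)=0$. $\Gamma$ is the set of finite cycles of $\mathbb{Z}^d$ (a cycle of length $n\ge2$ on distinct sites $x_1,\dots,x_n$ maps $x_i\mapsto x_{i+1}$ mod $n$ and fixes other sites; support $\{\gamma\}$), $w(\gamma)=\exp\{-\alpha\sum_{x\in\{\gamma\}}V(\gamma(x)-x)\}$; $\gamma\not\sim\gamma'$ if $\{\gamma\}\cap\{\gamma'\}\neq\emptyset$. $\mathcal N$ is a Poisson point process on $\Gamma\times\mathbb{R}\times\mathbb{R}^+$ with intensity $w(\gamma)\,dt\,e^{-s}ds$. For any point set $\mathcal M\subseteq\Gamma\times\mathbb{R}\times\mathbb{R}^+$ and $\varphi=(\gamma,t,s)$: $\mathcal A_1^\varphi(\mathcal M)=\{(\gamma',t',s')\in\mathcal M:\gamma'\not\sim\gamma,\ t'<t<t'+s'\}$, $\mathcal A_{n+1}^\varphi=\bigcup_{\varphi'\in\mathcal A_n^\varphi}\mathcal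 A_1^{\varphi'}$, clan $\mathcal A^\varphi=\bigcup_{n\ge1}\mathcal A^\varphi_n$; $\mathcal D_0=\emptyset$, $\mathcal K_n=\{\varphi\in\mathcal M:\mathcal A_1^\varphi\setminus\mathcal D_{n-1}=\emptyset\}$, $\mathcal D_n=\{\varphi\in\mathcal M:\mathcal A_1^\varphi\cap\mathcal K_n\ne\emptyset\}$, $\mathcal K(\mathcal M)=\bigcup_n\mathcal K_n$; and $\eta_t(\mathcal M)(\gamma)=\#\{(\gamma,t',s')\in\mathcal K(\mathcal M):t'\le t<t'+s'\}$. Set $\eta_t=\eta_t(\mathcal N)$, and for $\Lambda\subseteq\mathbb{Z}^d$, $\mathcal N^\Lambda=\{(\gamma,t,s)\in\mathcal N:\{\gamma\}\subset\Lambda\}$ and $\eta^\Lambda_t=\eta_t(\mathcal N^\Lambda)$. For finite $\Lambda$, $G_\Lambda$ is the probability on configurations $\eta\in\{0,1\}^\Gamma$ supported on those with $\eta(\gamma)=0$ unless $\{\gamma\}\subset\Lambda$ and with no two present cycles having intersecting supports, given by $G_\Lambda(\eta)\propto\prod_\gamma w(\gamma)^{\eta(\gamma)}$ (equivalently, the law on permutations fixing $\Lambda^c$ proportional to $\exp\{-\alpha\sum_{x\in\Lambda}V(\sigma(x)-x)\}$). *)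

(* Defs.v *)
From HB Require Import structures.
From mathcomp Require Import all_boot all_order all_algebra.
From mathcomp Require Import all_classical all_reals all_analysis.
Set Implicit Arguments. Unset Strict Implicit. Unset Printing Implicit Defensive.
Import Order.TTheory GRing.Theory Num.Theory.
Import numFieldNormedType.Exports.
Local Open Scope classical_set_scope.
Local Open Scope ring_scope.

Definition pp_site (d : nat) := 'rV[int]_d.

Definition pp_cyc_of_seq d (s : seq (pp_site d)) : pp_site d -> pp_site d :=
  fun x => if x \in s then nth x (rot 1 s) (index x s) else x.

Definition pp_is_cycle d (c : pp_site d -> pp_site d) : Prop :=
  exists s : seq (pp_site d), [/\ uniq s, (2 <= size s)%N & c = pp_cyc_of_seq s].

Record pp_cyc (d : nat) := pp_Cyc { pp_cmap :> pp_site d -> pp_site d ; pp_cmapP : pp_is_cycle pp_cmap }.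
HB.instance Definition _ d := gen_eqMixin (pp_cyc d).
HB.instance Definition _ d := gen_choiceMixin (pp_cyc d).

Definition pp_supp d (g : pp_cyc d) : set (pp_site d) := [set x | g x <> x].
Definition pp_incompat d (g g' : pp_cyc d) : Prop := pp_supp g `&` pp_supp g' !=set0.

Definition pp_weight (R : realType) d (alpha : R) (V : pp_site d -> \bar R) (g : pp_cyc d) : \bar R :=
  expeR (- (alpha%:E * (\big[adde/0%E]_(x \in pp_supp g) V (g x - x)%R))%E)%E.

Definition pp_strictly_convexE (R : realType) d (U : 'rV[R]_d -> \bar R) : Prop :=
  forall (x y : 'rV[R]_d) (l : R), x != y -> 0 < l < 1 ->
    (U x < +oo)%E -> (U y < +oo)%E ->
    (U (l *: x + (1 - l) *: y)%R < l%:E * U x + ((1 - l)%R)%:E * U y)%E.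

Definition pp_strictly_convex_potential (R : realType) d (V : pp_site d -> \bar R) : Prop :=
  (forall z, 0 <= V z)%E /\
  exists U : 'rV[R]_d -> \bar R, pp_strictly_convexE U /\
    (forall x, -oo < U x)%E /\
    (forall z : pp_site d, V z = U (map_mx (fun k : int => k%:~R) z)).

Definition pp_gpoint (R : realType) d := (pp_cyc d * R * R)%type.
Definition pp_pcyc (R : realType) d (p : pp_gpoint R d) : pp_cyc d := p.1.1.
Definition pp_ptime (R : realType) d (p : pp_gpoint R d) : R := p.1.2.
Definition pp_plife (R : realType) d (p : pp_gpoint R d) : R := p.2.

Definition pp_count (R : realType) d (M A : set (pp_gpoint R d)) : \bar R := (\esum_(x in M `&` A) 1)%E.

(* measurable subsets of Gamma x R x R (Gamma discrete) *)
Definition pp_pmeasurable (R : realType) d (A : set (pp_gpoint R d)) : Prop :=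
  forall g : pp_cyc d, measurable [set p : R * R | A ((g, p.1), p.2)].

Definition pp_intensity (R : realType) d (alpha : R) (V : pp_site d -> \bar R)
    (A : set (pp_gpoint R d)) : \bar R :=
  (\esum_(g in [set: pp_cyc d])
    (pp_weight alpha V g *
      \int[@lebesgue_measure R]_t
        \int[@lebesgue_measure R]_(s in [set s : R | (0 < s)%R /\ A ((g, t : R), s)])
           (expR (- s))%:E))%E.

Definition pp_poisson_p (R : realType) (r : R) (k : nat) : R :=
  r ^+ k / (k`!)%:R * expR (- r).

Definition pp_is_PPP (R : realType) d (alpha : R) (V : pp_site d -> \bar R)
    (dd : measure_display) (Om : measurableType dd) (P : probability Om R)
    (N : Om -> set (pp_gpoint R d)) : Prop :=
  forall (n : nat) (A : 'I_n -> set (pp_gpoint R d)) (k : 'I_n -> nat),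
    (forall i, pp_pmeasurable (A i)) ->
    (forall i, (pp_intensity alpha V (A i) < +oo)%E) ->
    (forall i j, i != j -> A i `&` A j = set0) ->
    let E := \bigcap_(i in [set: 'I_n]) [set om | pp_count (N om) (A i) = ((k i)%:R)%:E] in
    measurable E /\
    P E = (\prod_(i < n) pp_poisson_p (fine (pp_intensity alpha V (A i))) (k i))%:E.

Definition pp_A1 (R : realType) d (M : set (pp_gpoint R d)) (p : pp_gpoint R d) : set (pp_gpoint R d) :=
  [set q | M q /\ pp_incompat (pp_pcyc q) (pp_pcyc p) /\
           pp_ptime q < pp_ptime p < pp_ptime q + pp_plife q].

Fixpoint pp_Anc (R : realType) d (M : set (pp_gpoint R d)) (n : nat) (p : pp_gpoint R d) : set (pp_gpoint R d) :=
  match n with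
  | 0 => pp_A1 M p
  | n'.+1 => \bigcup_(q in pp_Anc M n' p) pp_A1 M q
  end.

Definition pp_clan (R : realType) d (M : set (pp_gpoint R d)) (p : pp_gpoint R d) : set (pp_gpoint R d) :=
  \bigcup_(n in [set: nat]) pp_Anc M n p.

Definition pp_Kfrom (R : realType) d (M D : set (pp_gpoint R d)) : set (pp_gpoint R d) :=
  [set p | M p /\ pp_A1 M p `\` D = set0].

(* pp_Dn M n = D_n ; K_{n+1} = pp_Kfrom M (pp_Dn M n) *)
Fixpoint pp_Dn (R : realType) d (M : set (pp_gpoint R d)) (n : nat) : set (pp_gpoint R d) :=
  match n with
  | 0 => set0
  | n'.+1 => [set p | M p /\ pp_A1 M p `&` pp_Kfrom M (pp_Dn M n') !=set0]
  end.

Definition pp_Kset (R : realType) d (M : set (pp_gpoint R d)) : set (pp_gpoint R d) :=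
  \bigcup_(n in [set: nat]) pp_Kfrom M (pp_Dn M n).

Definition pp_eta (R : realType) d (t : R) (M : set (pp_gpoint R d)) (g : pp_cyc d) : \bar R :=
  pp_count (pp_Kset M) [set p | pp_pcyc p = g /\ pp_ptime p <= t < pp_ptime p + pp_plife p].

Definition pp_restrict (R : realType) d (M : set (pp_gpoint R d)) (L : set (pp_site d)) : set (pp_gpoint R d) :=
  [set p | M p /\ pp_supp (pp_pcyc p) `<=` L].

Definition pp_finvol (I : Type) : set_system (set I) :=
  filter_from [set A | finite_set A] (fun A => [set B | A `<=` B /\ finite_set B]).

Definition pp_admissible d (L : set (pp_site d)) (S : set (pp_cyc d)) : Prop :=
  (forall g, S g -> pp_supp g `<=` L) /\
  (forall g g', S g -> S g' -> g <> g' -> ~ pp_incompat g g').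

Definition pp_GZ (R : realType) d (alpha : R) (V : pp_site d -> \bar R) (L : set (pp_site d))
    (f : (pp_cyc d -> R) -> R) : R :=
  \sum_(S \in pp_admissible L) (f (\1_S) * \big[*%R/1]_(g \in S) fine (pp_weight alpha V g)).

Definition pp_GE (R : realType) d (alpha : R) (V : pp_site d -> \bar R) (L : set (pp_site d))
    (f : (pp_cyc d -> R) -> R) : R :=
  pp_GZ alpha V L f / pp_GZ alpha V L (fun _ => 1).

(* Main.v *)
Require Import Defs.
From HB Require Import structures.
From mathcomp Require Import all_boot all_order all_algebra.
From mathcomp Require Import all_classical all_reals all_analysis.
From mathcomp Require Import measurable_realfun finmap zify ring lra.
Import Order.TTheory GRing.Theory Num.Theory.
Import numFieldNormedType.Exports.
Local Open Scope classical_set_scope.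
Local Open Scope ring_scope.

(** For finite [L] the restricted dynamics is a loss network: a cycle [g] tries to
    be born at rate [w g], lives an exponential time and is accepted iff it meets
    no accepted living cycle. To show that it has law [G_L] at time [t], cut
    [(t - T, t]] into slots of width [h] and record only the birth and death slots
    of the points. The free process seen at time [t - T], conditioned on being
    hard-core, has exactly the law [G_L]; started from it, the slotted chain is
    stationary up to [O(h^2)] per step. If no birth shares its slot with a death
    and all ancestors at time [t] are born after [t - T], the chain agrees with the
    dynamics whatever its initial state, so the conditioning, which only concerns
    points born before [t - T], is independent of the outcome. One-sided bounds
    suffice, since both laws have total mass 1. Letting [h] go to 0 and [T] to
    infinity along a Borel-Cantelli sequence also recovers the configuration at time
    [t] almost surely from counting events, although its measurability is not among
    the hypotheses. In infinite volume, finiteness of the clans makes the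
    state of a given cycle depend on finitely many points, so it is eventually
    constant in [L]; weak convergence follows by dominated convergence. *)

Set Implicit Arguments. Unset Strict Implicit. Unset Printing Implicit Defensive.

(** * Clans and kept points *)

Section Clans.
Context {R : realType} {d : nat}.
Implicit Types (M : set (pp_gpoint R d)) (p q r : pp_gpoint R d).

(** The hypotheses give probabilities only for counts on finitely many disjoint sets, which dictates
    the finite alphabet: an initial state together with a word is one specification of counts, of
    explicit probability. A realization with two births in one slot matches no word; that mass is
    lost, which lower bounds tolerate. Lifetimes are drawn at birth, so a state must carry death
    slots. No rate is known for the age of the oldest ancestor. The probability that two initial
    states lead to different outcomes is therefore never estimated: almost surely such disagreements
    stop, and continuity of the measure makes their probabilities vanish. Only clashes and the
    stationarity error are bounded explicitly. Clans are finite for every point of positive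
    lifetime, whether or not it belongs to the realization. A test point [(g, t, 1)] thus controls
    all cycles alive at time [t] that meet [g], along with their ancestors. *)

Lemma clanS M p q : pp_A1 M p q -> pp_clan M q `<=` pp_clan M p.
Proof.
move=> pq r [n _ nr]; exists n.+1 => //.
elim: n r nr => [|n IH] r /=; first by move=> qr; exists q.
by move=> [u qu ur]; exists u => //; exact: IH.
Qed.

Lemma A1_clan M p : pp_A1 M p `<=` pp_clan M p.
Proof. by move=> q pq; exists 0%N. Qed.

Lemma clan_A1 M p q r : pp_clan M p q -> pp_A1 M q r -> pp_clan M p r.
Proof. by move=> [n _ nq] qr; exists n.+1 => //=; exists q. Qed.

Lemma clan_time M p q : pp_clan M p q -> pp_ptime q < pp_ptime p.
Proof.
move=> [n _]; elim: n q => [|n IH] q /=; first by move=> [_ [_ /andP[]]].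
by move=> [u /IH up [_ [_ /andP[qu _]]]]; exact: lt_trans up.
Qed.

Lemma clan_mem M p q : pp_clan M p q -> M q.
Proof. by move=> [[|n] _ /=] => [[]|[u _ []]]. Qed.

Lemma clan_life M p q : pp_clan M p q -> 0 < pp_plife q.
Proof.
suff H u : pp_A1 M u q -> 0 < pp_plife q by move=> [[|n] _ /=] => [|[u _]]; apply: H.
move=> [_ [_ /andP[qu uq]]]; rewrite -(ltrD2l (pp_ptime q)) addr0.
exact: lt_trans uq.
Qed.

Lemma clan_sub M M' p : M `<=` M' -> pp_clan M p `<=` pp_clan M' p.
Proof.
move=> MM r [n _ nr]; exists n => //.
have A q : pp_A1 M q `<=` pp_A1 M' q by move=> u [/MM].
elim: n r nr => [|n IH] r /=; first exact: A.
by move=> [u /IH qu ur]; exists u => //; exact: A.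
Qed.

(** Ancestors are strictly older, so a first ancestor [q] lies in the clan of [p] but not in its
    own: the cardinal of the clan drops along [pp_A1]. *)
Lemma clan_ind M (Q : pp_gpoint R d -> Prop) :
  (forall p, finite_set (pp_clan M p) -> (forall q, pp_A1 M p q -> Q q) -> Q p) ->
  forall p, finite_set (pp_clan M p) -> Q p.
Proof.
move=> HQ p; have [n] := ubnP (#|` fset_set (pp_clan M p)|)%fset.
elim: n p => // n IH p; rewrite ltnS => np fp.
apply: HQ => // q pq.
have qp := clanS pq.
have fq := sub_finite_set qp fp.
apply: IH => //; apply: leq_trans np; apply: fproper_ltn_card.
rewrite fproperE; apply/andP; split; first by rewrite -fset_set_sub.
apply/negP; rewrite -fset_set_sub // => /(_ _ (A1_clan pq)) /clan_time.
by rewrite ltxx.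
Qed.

Lemma Dn_mono M m n : (m <= n)%N -> pp_Dn M m `<=` pp_Dn M n.
Proof.
have S k : pp_Dn M k `<=` pp_Dn M k.+1.
  elim: k => [|k IH] //= p [Mp [q [pq [Mq qD]]]]; split=> //; exists q; split => //; split => //.
  apply/seteqP; split=> // r [qr nr]; rewrite -qD; split => // /IH; exact: nr.
move=> /subnK <-; elim: (n - m)%N => [|k IH] //; rewrite addSn.
exact: subset_trans IH (S _).
Qed.

(** A point both kept and deleted would have a kept first ancestor that is itself deleted, since all
    first ancestors of a kept point are; repeating this lowers the stages, down to the empty
    [pp_Dn M 0]. *)
Lemma Kfrom_Dn M n m p : pp_Kfrom M (pp_Dn M n) p -> ~ pp_Dn M m p.
Proof.
have sub D q r : pp_Kfrom M D q -> pp_A1 M q r -> D r.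
  by move=> [_ qD] qr; apply: contrapT => nD; have : (set0 : set (pp_gpoint R d)) r by rewrite -qD.
elim: n m p => [|n IH] [|m] p Kp //= [Mp [q [pq Kq]]].
  exact: sub pq.
have /= [_ [r [qr Kr]]] := sub _ _ _ Kp pq.
exact: (IH m r Kr (sub _ _ _ Kq qr)).
Qed.

(** The staged construction becomes a recursion on ancestors. With an infinite clan a point might be
    neither kept nor deleted at any stage. *)
Lemma KsetP M p : M p -> finite_set (pp_clan M p) ->
  pp_Kset M p <-> forall q, pp_A1 M p q -> ~ pp_Kset M q.
Proof.
move=> Mp fp; split.
  move=> [n _ Kp] q pq [m _ Kq]; apply: (@Kfrom_Dn M n m.+1 p Kp) => /=.
  by split => //; exists q.
(* Every point with a finite clan is decided at some stage. *)
have kd : forall p, finite_set (pp_clan M p) -> M p -> pp_Kset M p \/ exists n, pp_Dn M n p.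
  apply: clan_ind => {Mp fp}p fp IH Mp.
  have [[q [pq Kq]]|nK] := pselect (exists q, pp_A1 M p q /\ pp_Kset M q).
    by case: Kq => n _ Kq; right; exists n.+1; split => //; exists q.
  left.
  have H q : exists n, pp_A1 M p q -> pp_Dn M n q.
    have [pq|] := pselect (pp_A1 M p q); last by exists 0%N.
    have Mq : M q by case: pq.
    case: (IH q pq Mq) => [Kq|[n nq]]; last by exists n.
    by exfalso; apply: nK; exists q.
  have [f fH] := choice H.
  have fA : finite_set (pp_A1 M p) by apply: sub_finite_set fp; exact: A1_clan.
  have [s sE] := (finite_seqP _).1 fA.
  (* All first ancestors are deleted by the latest of their stages, since [pp_Dn] increases. *)
  exists (\max_(q <- s) f q) => //; split => //.
  apply/seteqP; split => // r [pr]; apply.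
  apply: Dn_mono (fH _ pr).
  have : r \in s by have := pr; rewrite sE.
  by move=> rs; exact: (leq_bigmax_seq (F := f) (P := xpredT)).
move=> nK; case: (kd p fp Mp) => // -[[|n]] //= [_ [q [pq Kq]]].
by exfalso; apply: (nK q pq); exists n.
Qed.

Lemma Kset_sub M : pp_Kset M `<=` M.
Proof. by move=> p [n _ []]. Qed.

End Clans.

(** * Dependence on a finite region *)

Section Locality.
Context {R : realType} {d : nat}.
Implicit Types (M : set (pp_gpoint R d)) (p q r : pp_gpoint R d) (g : pp_cyc d).

(** A rotation of a duplicate-free sequence of length at least 2 moves every entry, so the support
    is the whole sequence. *)
Lemma cyc_seqP g : exists s : seq (pp_site d),
  [/\ uniq s, (2 <= size s)%N, pp_supp g = [set` s] & (g : _ -> _) = pp_cyc_of_seq s].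
Proof.
case: g => c [s [us s2 cE]]; exists s; split => //=.
apply/seteqP; split => x; rewrite /pp_supp /= cE /pp_cyc_of_seq; first by case: ifP.
move=> xs; rewrite xs => /eqP.
case: s us s2 xs {cE} => // a [//|b s] us _ xs.
rewrite -[X in _ == X](nth_index x xs).
set t := a :: b :: s in us xs *.
have it : (index x t < size t)%N by rewrite index_mem.
have [it1|it1] := ltnP (index x t).+1 (size t).
  have -> : nth x (rot 1 t) (index x t) = nth x t (index x t).+1.
    by rewrite /t rot1_cons nth_rcons /= -ltnS it1.
  by rewrite nth_uniq // gtn_eqF.
have e : index x t = (size t).-1 by apply: anti_leq; apply/andP; split; [exact: it|exact: it1].
have -> : nth x (rot 1 t) (index x t) = nth x t 0.
  by rewrite e /t rot1_cons nth_rcons /= ltnn eqxx.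
by rewrite nth_uniq // e.
Qed.

Lemma finite_supp g : finite_set (pp_supp g).
Proof. by have [s [_ _ -> _]] := cyc_seqP g; exact: finite_seq. Qed.

Lemma incompat_refl g : pp_incompat g g.
Proof.
have [[|a s] [_ s2 sE _]] := cyc_seqP g => //.
by exists a; rewrite setIid sE /= mem_head.
Qed.

Lemma incompat_sym g g' : pp_incompat g g' -> pp_incompat g' g.
Proof. by rewrite /pp_incompat setIC. Qed.

Lemma cyc_inj g g' : (g : pp_site d -> pp_site d) = g' -> g = g'.
Proof.
by case: g g' => [c cP] [c' cP'] /= e; subst c'; congr pp_Cyc; exact: Prop_irrelevance.
Qed.

(** The test point [(g, t, s)] need not belong to [M]. Both time inequalities are strict, whereas
    [pp_eta] admits births at [t] itself; those are excluded almost surely later on. *)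
Lemma clan_alive M g t s p : M p -> pp_incompat (pp_pcyc p) g ->
  pp_ptime p < t < pp_ptime p + pp_plife p -> pp_clan M (g, t, s) p.
Proof. by move=> Mp pg pt; exists 0%N. Qed.

(** By [KsetP] the fate of [p] is decided inside its clan, which the restriction to [B] leaves
    intact. *)
Lemma Kset_local M B p : finite_set (pp_clan M p) -> M p ->
  (forall q, (q = p \/ pp_clan M p q) -> pp_supp (pp_pcyc q) `<=` B) ->
  pp_Kset (pp_restrict M B) p <-> pp_Kset M p.
Proof.
move=> fp Mp; move: p fp Mp; apply: clan_ind => p fp IH Mp pB.
have A1E : pp_A1 (pp_restrict M B) p = pp_A1 M p.
  apply/seteqP; split=> q; first by move=> [[Mq _] ?].
  move=> [Mq qp]; split => //; split => //; apply: pB; right.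
  by apply: A1_clan.
have subc : pp_clan (pp_restrict M B) p `<=` pp_clan M p by apply: clan_sub => q [].
have IH' q : pp_A1 M p q -> pp_Kset (pp_restrict M B) q <-> pp_Kset M q.
  move=> pq; apply: IH => //; first by case: pq.
  move=> r [->|qr]; apply: pB; right; first exact: A1_clan.
  exact: clanS qr.
rewrite KsetP.
- rewrite KsetP // A1E.
  by split=> H q pq; have := H q pq; rewrite IH'.
- by split => //; apply: pB; left.
- exact: sub_finite_set fp.
Qed.

(** The finite set is the union of the supports over the clan of the test point [(g, t, 1)], which
    contains every point of cycle [g] alive at [t] and all its ancestors. *)
Lemma eta_local M (t : R) :
  (forall p, 0 < pp_plife p -> finite_set (pp_clan M p)) ->
  (forall p, M p -> pp_ptime p <> t) ->
  forall g, exists2 A : set (pp_site d), finite_set A &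
    forall B, A `<=` B -> pp_eta t (pp_restrict M B) g = pp_eta t M g.
Proof.
move=> fM nt g; set C := pp_clan M (g, t, 1).
have fC : finite_set C by apply: fM; rewrite /pp_plife /=.
exists (\bigcup_(q in C) pp_supp (pp_pcyc q)).
  by apply: bigcup_finite => // q _; exact: finite_supp.
move=> B AB; rewrite /pp_eta /pp_count; congr (\esum_(x in _) _)%E.
have CK p : M p -> pp_pcyc p = g -> pp_ptime p <= t < pp_ptime p + pp_plife p ->
    pp_Kset (pp_restrict M B) p <-> pp_Kset M p.
  move=> Mp pg /andP[tp pt].
  have Cp : C p.
    apply: clan_alive => //; first by rewrite pg; exact: incompat_refl.
    by rewrite pt andbT lt_neqAle tp andbT; apply/eqP; exact: nt.
  apply: Kset_local => //.
    apply: fM; exact: clan_life Cp.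
  move=> q [->|pq] x qx; apply: AB; first by exists p.
  exists q => //; case: Cp => n _; elim: n p pq {Mp pg tp pt} => [|n IH] p pq /=.
    by move=> pC; exact: clanS pC _ pq.
  by move=> [u un up]; apply: IH un; exact: clanS up _ pq.
apply/seteqP; split=> p [/= Kp [pg pt]]; split => //.
  by have [Mp _] := Kset_sub Kp; apply/CK.
by have Mp := Kset_sub Kp; apply/CK.
Qed.

End Locality.

Section Counts.
Context {R : realType} {d : nat}.
Implicit Types (M A : set (pp_gpoint R d)).

Lemma count0P M A : pp_count M A = 0%E <-> M `&` A = set0.
Proof.
rewrite /pp_count; split => [h|->]; last exact: esum_set0.
apply: contrapT => /eqP/set0P[p Ap].
have : (1 <= 0 :> \bar R)%E.
  rewrite -[X in (_ <= X)%E]h; apply: esum_ge; exists [set p].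
    by split; [exact: finite_set1|move=> q ->].
  by rewrite fsbig_set1.
by rewrite lee_fin ler10.
Qed.

Lemma count1P M A : pp_count M A = 1%E <-> exists p, M `&` A = [set p].
Proof.
rewrite /pp_count; split => [h|[p ->]]; last by rewrite esum_set1.
have [p Ap] : (M `&` A) !=set0.
  by apply/set0P/eqP => e; move: h; rewrite e esum_set0 => -[] /esym/eqP; rewrite oner_eq0.
exists p; apply/seteqP; split => [q Aq /=|q ->//].
apply: contrapT => qp.
have : (2%:R%:E <= 1 :> \bar R)%E.
  rewrite -[X in (_ <= X)%E]h; apply: esum_ge; exists [set p; q].
    by split; [exact: finite_set2|move=> r [->|->]].
  rewrite fsbigU0 //=; last by move=> r [/= -> /= pq]; apply: qp.
  by rewrite !fsbig_set1 /= -EFinD.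
by rewrite lee_fin lern1.
Qed.

End Counts.

(** * The slotted chain *)

Section Chain.
Variables (R : realType) (d n m : nat) (c : 'I_n -> pp_cyc d) (tau : nat -> R).
Implicit Types (M F : set (pp_gpoint R d)) (p q r : pp_gpoint R d).

(* Birth slot [0] is [(-oo, tau 0]], death slot [m.+1] is [(tau m, +oo)]. *)
Definition birth_slot (i : nat) (x : R) : bool :=
  ((i == 0) || (tau i.-1 < x)) && (x <= tau i).

Definition death_slot (j : nat) (x : R) : bool :=
  [&& (0 < j)%N, tau j.-1 < x & (j <= m)%N ==> (x <= tau j)].

Definition pdeath p := pp_ptime p + pp_plife p.

Definition cell (g : 'I_n) (i j : nat) : set (pp_gpoint R d) :=
  [set p | [/\ pp_pcyc p = c g, 0 < pp_plife p, birth_slot i (pp_ptime p)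
             & death_slot j (pdeath p)]].

Definition inc (g g' : 'I_n) : bool := `[< pp_incompat (c g) (c g') >].

(* A state gives the death slot of each occupied cycle; [ord0] codes an unoccupied
   cycle, since no death falls in slot [0]. A letter is the only birth of a slot,
   if any, with its death slot. Words are read from the last slot to the first. *)
Definition state := {ffun 'I_n -> 'I_m.+2}.
Definition letter := option ('I_n * 'I_m.+2).

Definition compat (z : state) (g : 'I_n) : bool :=
  [forall g', (z g' != ord0) ==> ~~ inc g' g].

(** A birth whose death also falls in slot [i] is dropped. Compatibility is tested before the deaths
    of slot [i] are applied, so a dying cycle still blocks; this can differ from the dynamics only
    when a birth and a death share the slot. *)
Definition step (i : nat) (z : state) (x : letter) : state :=
  [ffun g => let old := if z g == i :> nat then ord0 else z g in
    if x is Some (g0, j) then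
      if [&& g == g0, (i < j)%N & compat z g0] then j else old
    else old].

Fixpoint run (z : state) (s : seq letter) : state :=
  if s is x :: s' then step (size s').+1 (run z s') x else z.

Definition occupied (z : state) : {set 'I_n} := [set g | z g != ord0].

Lemma incE g g' : reflect (pp_incompat (c g) (c g')) (inc g g').
Proof. exact: asboolP. Qed.

Lemma inc_refl g : inc g g.
Proof. by apply/incE; exact: incompat_refl. Qed.

Hypothesis tau_homo : {homo tau : i j / (i <= j)%N >-> i <= j}.
Hypothesis c_inj : injective c.

(** [F] is later the union of the clans of the test points at the final time. It is closed under
    ancestors and born after [tau 0], so the fate of its points ignores the initial state. *)
Variables (M F : set (pp_gpoint R d)).
Hypothesis M_cyc : forall p, M p -> exists g, pp_pcyc p = c g.
Hypothesis F_sub : F `<=` M.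
Hypothesis F_closed : forall p, F p -> pp_A1 M p `<=` F.
Hypothesis F_life : forall p, F p -> 0 < pp_plife p.
Hypothesis F_late : forall p, F p -> tau 0 < pp_ptime p.
Hypothesis F_fin : forall p, F p -> finite_set (pp_clan M p).

Hypothesis no_clash : forall i p q, (0 < i <= m)%N -> M p -> M q ->
  0 < pp_plife p -> birth_slot i (pp_ptime p) ->
  0 < pp_plife q -> pp_ptime q <= tau i.-1 -> tau i.-1 < pdeath q <= tau i -> False.

(** Position [size s - i] holds the letter of slot [i]. No word matches if one of these slots holds
    two births. *)
Definition matches (s : seq letter) : Prop :=
  forall i, (0 < i <= size s)%N -> forall g (j : 'I_m.+2),
    (nth None s (size s - i) = Some (g, j) -> exists p, M p /\ cell g i j p) /\
    (forall p, M p -> cell g i j p -> nth None s (size s - i) = Some (g, j) /\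
      forall q, M q -> cell g i j q -> q = p).

(* Occupied cycles coming from outside [F] may be artefacts of the initial state:
   nothing is claimed about [pp_Kset] for them. *)
Definition tracks (k : nat) (z : state) : Prop :=
  (forall g, z g != ord0 -> exists q, [/\ M q, pp_pcyc q = c g, 0 < pp_plife q,
      pp_ptime q <= tau k & death_slot (z g) (pdeath q)] /\
      ((k < z g)%N /\ (F q -> pp_Kset M q))) /\
  (forall p g (j : 'I_m.+2), F p -> pp_Kset M p -> pp_ptime p <= tau k ->
      pp_pcyc p = c g -> death_slot j (pdeath p) -> (k < j)%N -> z g = j).

Lemma death_slotP k x : (k <= m)%N -> tau k < x ->
  exists2 j : 'I_m.+2, death_slot j x & (k < j)%N.
Proof.
move=> km kx; have [mx|xm] := ltP (tau m) x.
  by exists ord_max; rewrite /= ?ltnS // /death_slot /= mx ltnn.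
have [j jP jmin] := ex_minnP (ex_intro (fun j => x <= tau j) m xm).
have kj : (k < j)%N by rewrite ltnNge; apply/negP => /tau_homo/(le_trans jP); rewrite leNgt kx.
have jm : (j <= m)%N by exact: jmin.
have jm2 : (j < m.+2)%N by lia.
exists (Ordinal jm2) => //=; rewrite /death_slot jP implybT andbT (leq_ltn_trans _ kj) //=.
rewrite ltNge; apply/negP => /jmin; lia.
Qed.

Lemma death_slot_gt i j x : (i < j)%N -> death_slot j x -> tau i < x.
Proof. by move=> ij /and3P[_ jx _]; apply: le_lt_trans jx; apply: tau_homo; lia. Qed.

(** The recursion [KsetP] is followed one slot at a time. A point of [F] born in this slot and
    outliving it is accepted iff no incompatible cycle is occupied: its first ancestors lie in [F],
    were born in earlier slots and outlive the present one, so the kept ones are tracked; conversely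
    an occupied incompatible cycle comes from a first ancestor, hence from a kept point. *)
Lemma tracks_step s x : (size s < m)%N -> matches (x :: s) ->
  forall z, tracks (size s) z -> tracks (size s).+1 (step (size s).+1 z x).
Proof.
move=> sm mt z [T1 T2]; set k := size s in sm mt T1 T2 *.
have xP g (j : 'I_m.+2) : (x = Some (g, j) -> exists p, M p /\ cell g k.+1 j p) /\
    (forall p, M p -> cell g k.+1 j p -> x = Some (g, j) /\
      forall q, M q -> cell g k.+1 j q -> q = p).
  by have := mt k.+1; rewrite /= ltnS leqnn subnn /=; exact.
have tauk : tau k <= tau k.+1 by exact: tau_homo.
have later p : 0 < pp_plife p -> pp_ptime p < pdeath p by move=> ?; rewrite /pdeath ltrDl.
split.
- move=> g; rewrite ffunE.
  have old : (if z g == k.+1 :> nat then ord0 else z g) != ord0 -> exists q,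
     [/\ M q, pp_pcyc q = c g, 0 < pp_plife q, pp_ptime q <= tau k.+1 &
      death_slot (if z g == k.+1 :> nat then ord0 else z g) (pdeath q)] /\
     ((k.+1 < (if z g == k.+1 :> nat then ord0 else z g))%N /\ (F q -> pp_Kset M q)).
    case: ifPn => // zk z0; have [q [[Mq qg lq tq dq] [kz Kq]]] := T1 g z0.
    exists q; split; last by split=> //; lia.
    by split => //; exact: le_trans tauk.
  case xE : x => [[g0 j]|]; last exact: old.
  case: (boolP [&& g == g0, (k.+1 < j)%N & compat z g0]) => [|_]; last exact: old.
  move=> /and3P[/eqP -> kj cz] _.
  have [p [Mp pc]] := (xP g0 j).1 xE.
  have [pg lp /andP[/= bp1 bp2] dp] := pc.
  exists p; split => //; split => // Fp.
  apply/KsetP => //; first exact: F_fin.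
  move=> q pq Kq; have Fq := F_closed Fp pq.
  have [Mq [qp /andP[tqp tpq]]] := pq.
  have lq := F_life Fq.
  have [g' qg'] := M_cyc Mq.
  (* An ancestor born in the same slot would be a second birth there. *)
  have [tqk|tqk] := leP (pp_ptime q) (tau k); last first.
    have [j' dj' kj'] := death_slotP (ltnW sm) (lt_trans tqk (later _ lq)).
    have qc : cell g' k.+1 j' q.
      split => //; rewrite /birth_slot /= tqk /=; exact: le_trans (ltW tqp) bp2.
    have [] := (xP g' j').2 q Mq qc; rewrite xE => -[eg ej] uq; subst g' j'.
    by move: tqp; rewrite -(uq p Mp pc) ltxx.
  have dq : tau k.+1 < pdeath q.
    rewrite ltNge; apply/negP => dq.
    apply: (@no_clash k.+1 p q) => //=; first by rewrite /birth_slot /= bp1.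
    by rewrite dq andbT; apply: lt_trans bp1 tpq.
  have [j' dj' kj'] := death_slotP sm dq.
  have zg' := T2 q g' j' Fq Kq tqk qg' dj' (ltnW kj').
  have j'0 : j' != ord0 by rewrite -val_eqE /=; lia.
  move: cz => /forallP/(_ g'); rewrite zg' j'0 /= => /negP; apply.
  by apply/incE; rewrite -qg' -pg.
- move=> p g j Fp Kp tp pg dp kj; rewrite ffunE.
  have [tpk|tpk] := leP (pp_ptime p) (tau k).
    have zg := T2 p g j Fp Kp tpk pg dp (ltnW kj).
    have -> : (if z g == k.+1 :> nat then ord0 else z g) = j.
      by rewrite zg; case: ifP => // /eqP; lia.
    case: x {xP mt} => [[g0 j0]|//].
    case: (boolP [&& g == g0, (k.+1 < j0)%N & compat z g0]) => //.
    move=> /and3P[/eqP eg _ /forallP/(_ g)]; rewrite -eg inc_refl zg.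
    have -> : j != ord0 by rewrite -val_eqE /=; lia.
    by [].
  have pc : cell g k.+1 j p by split => //; [exact: F_life|rewrite /birth_slot /= tpk].
  have [-> _] := (xP g j).2 p (F_sub Fp) pc.
  rewrite eqxx kj /=; suff -> : compat z g by [].
  apply/forallP => g'; apply/implyP => zg'; apply/negP => /incE ig.
  have [q [[Mq qg lq tq dq] [kz Kq]]] := T1 g' zg'.
  (* Otherwise [q] would die in the slot in which [p] is born. *)
  have tpq : pp_ptime p < pdeath q.
    have [zk|zk] := eqVneq (z g' : nat) k.+1.
      exfalso; apply: (@no_clash k.+1 p q) => //=; [exact: F_sub|exact: F_life|..].
        by rewrite /birth_slot /= tpk.
      move: dq; rewrite zk => /and3P[_ /= -> /implyP]; exact.
    apply: le_lt_trans tp _; apply: death_slot_gt dq; lia.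
  have pq : pp_A1 M p q.
    split => //; split; first by rewrite qg pg.
    by rewrite tpq andbT; apply: le_lt_trans tpk.
  have := (KsetP (F_sub Fp) (F_fin Fp)).1 Kp q pq; apply; apply: Kq.
  exact: F_closed pq.
Qed.

Lemma matches_behead x s : matches (x :: s) -> matches s.
Proof.
move=> h i /andP[i0 im] g j; have := h i.
rewrite /= i0 (leq_trans im (leqnSn _)) => /(_ isT g j).
by have -> : ((size s).+1 - i = (size s - i).+1)%N by lia.
Qed.

Lemma tracks_run z s : (size s <= m)%N -> matches s -> tracks 0 z ->
  tracks (size s) (run z s).
Proof.
elim: s => // x s IH sm mt tz /=.
by apply: tracks_step => //; apply: IH => //; [exact: ltnW|exact: matches_behead mt].
Qed.

(** At time [tau 0] no point of [F] is born yet, so all claims on [pp_Kset] are void and any initial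
    state backed by points will do. *)
Lemma tracks_init (z : state) :
  (forall g, z g != ord0 -> exists q, M q /\ cell g 0 (z g) q) -> tracks 0 z.
Proof.
move=> h; split => [g zg|p g j Fp _ tp].
  have [q [Mq [qg lq /andP[_ bq] dq]]] := h g zg.
  exists q; split => //; split; first by rewrite lt0n; apply: contra zg => /eqP zg; apply/eqP/val_inj.
  by move=> /F_late; rewrite ltNge bq.
by have := F_late Fp; rewrite ltNge tp.
Qed.

(** Every point alive at [tau m] is in [F], so the artefacts are gone. Multiplicity is at most one:
    of two kept points of the same cycle alive at [tau m], the older would be an ancestor of the
    younger; if born together, they share a cell, which holds one point. *)
Lemma tracks_eta z s : size s = m -> matches s -> tracks m z ->
  (forall p, M p -> pp_ptime p <= tau m < pdeath p -> F p) ->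
  forall g : pp_cyc d, pp_eta (tau m) M g = (\1_(c @` [set` occupied z]) g)%:E.
Proof.
move=> sm mt [T1 T2] alive g; rewrite indicE.
have Fk p : M p -> pp_ptime p <= tau m < pdeath p -> exists2 i, (0 < i <= m)%N &
    birth_slot i (pp_ptime p).
  move=> Mp pm; have /andP[tp _] := pm; have /F_late := alive _ Mp pm; move=> t0.
  have [i iP imin] := ex_minnP (ex_intro (fun j => pp_ptime p <= tau j) m tp).
  have i0 : (0 < i)%N by rewrite lt0n; apply/eqP => i0; move: iP; rewrite i0 leNgt t0.
  exists i; first by rewrite i0 /=; exact: imin.
  rewrite /birth_slot iP andbT ltNge; apply/orP; right; apply/negP => /imin; lia.
have dm p : tau m < pdeath p -> death_slot m.+1 (pdeath p).
  by move=> h; rewrite /death_slot /= h ltnn.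
rewrite /pp_eta; have [gz|ng] := pselect ((c @` [set` occupied z]) g); last first.
  rewrite memNset //; apply/count0P; apply/seteqP; split => // r /= [Kr [rg rm]].
  apply: ng => /=.
  have Mr := Kset_sub Kr; have Fr := alive r Mr rm.
  have [a ra] := M_cyc Mr; exists a; last by rewrite -ra.
  have /andP[r1 r2] := rm.
  by rewrite /= inE (T2 r a ord_max Fr Kr r1 ra (dm r r2)).
rewrite mem_set //; case: gz => a /=; rewrite inE => za ag; apply/count1P.
  have [q [[Mq qg lq tq dq] [kz Kq]]] := T1 a za.
  have tmq : tau m < pdeath q by exact: death_slot_gt dq.
  have qm : pp_ptime q <= tau m < pdeath q by rewrite tq.
  have Fq := alive q Mq qm; have {}Kq := Kq Fq.
  exists q; apply/seteqP; split => [r /= [Kr [rg rm]]|r -> /=]; last by rewrite qg.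
  have Mr := Kset_sub Kr; have Fr := alive r Mr rm.
  have lem p p' : pp_pcyc p = g -> pp_pcyc p' = g -> F p -> F p' -> pp_Kset M p ->
      pp_Kset M p' -> pp_ptime p' <= tau m < pdeath p' -> tau m < pdeath p ->
      pp_ptime p <= tau m -> ~ (pp_ptime p < pp_ptime p').
    move=> pg pg' Fp Fp' Kp Kp' /andP[t' d'] dp tp pp'.
    have pA : pp_A1 M p' p.
      split; first exact: F_sub.
      split; first by rewrite pg pg'; exact: incompat_refl.
      by rewrite pp'; exact: le_lt_trans dp.
    exact: ((KsetP (F_sub Fp') (F_fin Fp')).1 Kp' p pA).
  have qr : pp_ptime q = pp_ptime r.
    have /andP[r1 r2] := rm.
    by case: (ltgtP (pp_ptime q) (pp_ptime r)) => //;
      [move/(lem q r) => []//; rewrite qg|move/(lem r q) => []//; rewrite qg].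
  have [i im bi] := Fk q Mq qm.
  have qc : cell a i (ord_max : 'I_m.+2) q by split => //; exact: dm.
  have rc : cell a i (ord_max : 'I_m.+2) r.
    split => //; [by rewrite rg|exact: F_life|by rewrite -qr|apply: dm].
    by case/andP : rm.
  have := (mt i _ a ord_max).2 q Mq qc; rewrite sm => /(_ im)[_]; exact.
Qed.

End Chain.

(** * Intensities *)

Section ExpIntegrals.
Context {R : realType}.
Local Notation mu := (@lebesgue_measure R).

Lemma continuous_affine_expR (a b k : R) : continuous (fun x : R => a + b * expR (k * x)).
Proof.
move=> x; apply: cvgD; first exact: cvg_cst.
apply: cvgM; first exact: cvg_cst.
apply: continuous_comp; last exact: continuous_expR.
by apply: cvgM; [exact: cvg_cst|exact: cvg_id].
Qed.

Lemma integral_affine_expR (a b x y : R) : x <= y ->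
  (\int[mu]_(t in `]x, y]) (a + b * expR t)%:E = (a * (y - x) + b * (expR y - expR x))%:E)%E.
Proof.
rewrite le_eqVlt => /predU1P[->|xy].
  by rewrite set_itvoc0 integral_set0 !subrr !mulr0 addr0.
have cf : continuous (fun t : R => a + b * expR t).
  by have := @continuous_affine_expR a b 1; under eq_fun do rewrite mul1r.
rewrite integral_itv_obnd_cbnd; last first.
  by apply/measurable_EFinP; apply: measurable_funTS; exact: continuous_measurable_fun.
have dF (t : R) : is_derive t 1 (fun t : R => a * t + b * expR t) (a + b * expR t).
  by apply: is_deriveD; rewrite -[X in is_derive _ _ _ X]mulr1 ?mulr1;
    apply: is_derive_eq; rewrite /GRing.scale /= ?mulr1.
have cF : continuous (fun t : R => a * t + b * expR t).
  by move=> z; exact/differentiable_continuous/derivable1_diffP/ex_derive.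
rewrite (@continuous_FTC2 _ _ (fun t => a * t + b * expR t) _ _ xy).
- by rewrite -EFinB; congr EFin; ring.
- exact: continuous_subspaceT.
- split.
  + by move=> z _; exact: ex_derive.
  + exact/cvg_at_right_filter/cF.
  + exact/cvg_at_left_filter/cF.
- by move=> z _; rewrite derive1E derive_val.
Qed.

Lemma integral_expRN_itvoc (x y : R) : x <= y ->
  (\int[mu]_(s in `]x, y]) (expR (- s))%:E = (expR (- x) - expR (- y))%:E)%E.
Proof.
rewrite le_eqVlt => /predU1P[->|xy].
  by rewrite set_itvoc0 integral_set0 !subrr.
have cE : continuous (fun t : R => expR (- t)).
  by have := @continuous_affine_expR 0 1 (-1); under eq_fun do rewrite add0r mul1r mulN1r.
have dF (t : R) : is_derive t 1 (fun t : R => - expR (- t)) (expR (- t)).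
  by apply: is_derive_eq; rewrite /GRing.scale /= ?mulN1r ?mulrN1 opprK.
have cF : continuous (fun t : R => - expR (- t)).
  by move=> z; exact/differentiable_continuous/derivable1_diffP/ex_derive.
rewrite integral_itv_obnd_cbnd; last first.
  by apply/measurable_EFinP; apply: measurable_funTS; exact: continuous_measurable_fun.
rewrite (@continuous_FTC2 _ _ (fun t => - expR (- t)) _ _ xy).
- by rewrite -EFinB; congr EFin; ring.
- exact: continuous_subspaceT.
- split.
  + by move=> z _; exact: ex_derive.
  + exact/cvg_at_right_filter/cF.
  + exact/cvg_at_left_filter/cF.
- by move=> z _; rewrite derive1E derive_val.
Qed.

Lemma integral_expRN_itvoy (x : R) :
  (\int[mu]_(s in `]x, +oo[) (expR (- s))%:E = (expR (- x))%:E)%E.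
Proof.
have cE : continuous (fun t : R => expR (- t)).
  by have := @continuous_affine_expR 0 1 (-1); under eq_fun do rewrite add0r mul1r mulN1r.
have dF (t : R) : is_derive t 1 (fun t : R => - expR (- t)) (expR (- t)).
  by apply: is_derive_eq; rewrite /GRing.scale /= ?mulN1r ?mulrN1 opprK.
have cF : continuous (fun t : R => - expR (- t)).
  by move=> z; exact/differentiable_continuous/derivable1_diffP/ex_derive.
rewrite integral_itv_obnd_cbnd; last first.
  by apply/measurable_EFinP; apply: measurable_funTS; exact: continuous_measurable_fun.
rewrite (@ge0_continuous_FTC2y _ _ (fun t => - expR (- t)) _ 0).
- by rewrite -EFinB; congr EFin; ring.
- by move=> z _; exact: expR_ge0.
- exact: continuous_subspaceT.
- by rewrite -oppr0; apply: cvgN; exact: cvgr_expR.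
- by move=> z _; exact: ex_derive.
- exact/cvg_at_right_filter/cF.
- by move=> z _; rewrite derive1E derive_val.
Qed.

Lemma integral_expR_itvNyc (b y : R) : 0 <= b ->
  (\int[mu]_(t in `]-oo, y]) (b * expR t)%:E = (b * expR y)%:E)%E.
Proof.
move=> b0.
have cE : continuous (fun t : R => b * expR t).
  by have := @continuous_affine_expR 0 b 1; under eq_fun do rewrite add0r mul1r.
rewrite -{1}(opprK y) ge0_integration_by_substitutionNy; first last.
- by move=> z _; rewrite mulr_ge0 ?expR_ge0.
- exact: continuous_subspaceT.
rewrite -integral_itv_obnd_cbnd; last first.
  apply/measurable_EFinP; apply: measurable_funTS; apply: continuous_measurable_fun.
  by have := @continuous_affine_expR 0 b (-1); under eq_fun do rewrite add0r mulN1r.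
under eq_integral do rewrite /= EFinM.
rewrite ge0_integralZl //; first by rewrite integral_expRN_itvoy opprK.
apply/measurable_EFinP; apply: measurable_funTS; apply: continuous_measurable_fun.
by have := @continuous_affine_expR 0 1 (-1); under eq_fun do rewrite add0r mul1r mulN1r.
Qed.

End ExpIntegrals.

Section Intensity.
Context {R : realType} {d : nat}.
Variables (alpha : R) (V : pp_site d -> \bar R).
Hypothesis alpha0 : 0 < alpha.
Hypothesis V0 : forall z, (0 <= V z)%E.
Local Notation mu := (@lebesgue_measure R).

Lemma weight_bounds g : (0 <= pp_weight alpha V g <= 1)%E.
Proof.
rewrite /pp_weight expeR_ge0 /= -(@expeR0 R) lee_expeR leeNl oppe0.
rewrite mule_ge0 ?lee_fin ?(ltW alpha0) //; apply: fsume_ge0 => x _; exact: V0.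
Qed.

Definition weight g : R := fine (pp_weight alpha V g).

Lemma weightE g : pp_weight alpha V g = (weight g)%:E.
Proof.
have /andP[w0 w1] := weight_bounds g; rewrite fineK // ge0_fin_numE //.
exact: le_lt_trans w1 (ltry _).
Qed.

Lemma weight_ge0 g : 0 <= weight g.
Proof. by rewrite -lee_fin -weightE; have /andP[] := weight_bounds g. Qed.

Lemma weight_le1 g : weight g <= 1.
Proof. by rewrite -lee_fin -weightE; have /andP[] := weight_bounds g. Qed.

Definition box (g : pp_cyc d) (B D : set R) : set (pp_gpoint R d) :=
  [set p | [/\ pp_pcyc p = g, 0 < pp_plife p, B (pp_ptime p) & D (pdeath p)]].

Lemma box_pmeasurable g B D : measurable B -> measurable D -> pp_pmeasurable (box g B D).
Proof.
move=> mB mD g'; have [<-|gg'] := pselect (g' = g); last first.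
  rewrite [X in measurable X](_ : _ = set0) //.
  by apply/seteqP; split => // p -[].
rewrite [X in measurable X](_ : _ = (snd @^-1` `]0, +oo[) `&` (fst @^-1` B) `&`
   ((fun p : R * R => p.1 + p.2) @^-1` D)).
  have mT : measurable [set: R * R] by [].
  apply: measurableI; first apply: measurableI.
  - by rewrite -[X in measurable X]setTI; apply: measurable_snd.
  - by rewrite -[X in measurable X]setTI; apply: measurable_fst.
  - rewrite -[X in measurable X]setTI.
    by apply: (measurable_funD (f := fst) (g := snd)).
apply/seteqP; split => p /=; rewrite in_itv /= andbT.
  by move=> [].
by move=> [[]].
Qed.

Lemma intensity_box g (B D : set R) (v : R) : 
  (\int[mu]_(t in B) \int[mu]_(s in [set s : R | (0 < s)%R /\ D ((t : R) + s)%R]) (expR (- s))%:E = v%:E)%E ->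
  pp_intensity alpha V (box g B D) = (weight g * v)%:E.
Proof.
move=> vE; rewrite /pp_intensity.
pose a g' := (pp_weight alpha V g' * \int[mu]_t \int[mu]_(s in
   [set s : R | (0 < s)%R /\ (box g B D) ((g', t : R), s)]) (expR (- s))%:E)%E.
have aE g' : a g' = if g' \in [set g] then (weight g * v)%:E else 0%E.
  rewrite /a; case: ifPn => [/set_mem ->|/negP gg'].
    rewrite weightE EFinM -vE; congr *%E; rewrite [RHS]integral_mkcond.
    apply: eq_integral => t _; rewrite patchE; case: ifPn => [/set_mem Bt|/negP nBt].
      congr (\int[mu]_(s in _) _)%E; apply/seteqP; split => s /=; first by move=> [? []].
      by move=> [? ?].
    rewrite [X in integral _ X](_ : _ = set0) ?integral_set0 //.
    by apply/seteqP; split => // s [_ [_ _ Bt _]]; apply: nBt; exact: mem_set.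
  rewrite [X in (_ * X)%E](_ : _ = 0%E) ?mule0 //.
  rewrite (eq_integral (fun=> 0%E)) ?integral0 // => t _.
  rewrite [X in integral _ X](_ : _ = set0) ?integral_set0 //.
  by apply/seteqP; split => // s [_ [e _ _ _]]; apply: gg'; exact: mem_set.
rewrite (eq_esum (b := fun g' => if g' \in [set g] then (weight g * v)%:E else 0%E)).
  rewrite -(esum_mkcond [set g] (fun=> (weight g * v)%:E)) esum_set1 //.
  rewrite EFinM mule_ge0 ?lee_fin ?weight_ge0 // -lee_fin -vE.
  by apply: integral_ge0 => t _; apply: integral_ge0 => s _; rewrite lee_fin expR_ge0.
by move=> g' _; exact: aE.
Qed.

End Intensity.

(** * Masses of the slots *)

Section Grid.
Context {R : realType}.
Local Notation mu := (@lebesgue_measure R).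
Variables (m : nat) (t0 h : R).
Hypothesis h0 : 0 <= h.

Definition grid_time (k : nat) : R := t0 + k%:R * h.
Local Notation tau := grid_time.

Lemma grid_time_homo : {homo tau : i j / (i <= j)%N >-> i <= j}.
Proof. by move=> i j ij; rewrite lerD2l ler_wpM2r // ler_nat. Qed.

Definition bset i := [set x | birth_slot tau i x].
Definition dset j := [set x | death_slot m tau j x].

Lemma bset0 : bset 0 = `]-oo, tau 0]%classic.
Proof. by apply/seteqP; split=> x; rewrite /bset /birth_slot /= in_itv. Qed.

Lemma bsetS i : bset i.+1 = `]tau i, tau i.+1]%classic.
Proof. by apply/seteqP; split=> x; rewrite /bset /birth_slot /= in_itv. Qed.

Lemma dset0 : dset 0 = set0.
Proof. by apply/seteqP; split=> x. Qed.

Lemma dsetS j : (j < m)%N -> dset j.+1 = `]tau j, tau j.+1]%classic.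
Proof.
by move=> jm; apply/seteqP; split=> x; rewrite /dset /death_slot /= in_itv /= jm.
Qed.

Lemma dset_last : dset m.+1 = `]tau m, +oo[%classic.
Proof. by apply/seteqP; split=> x; rewrite /dset /death_slot /= in_itv /= ltnn. Qed.

Lemma bset_measurable i : measurable (bset i).
Proof. by case: i => [|i]; rewrite ?bset0 ?bsetS. Qed.

Lemma dset_measurable j : (j <= m.+1)%N -> measurable (dset j).
Proof.
case: j => [|j]; first by rewrite dset0.
by rewrite ltnS leq_eqVlt => /predU1P[->|jm]; rewrite ?dset_last ?dsetS.
Qed.

(* [surv j = exp(- tau j)], cut to [0] past the horizon, so that its increments
   are the masses of the death slots *)
Definition surv (j : nat) : R := if (j <= m)%N then expR (- tau j) else 0.
Definition death_mass (j : nat) : R := surv j.-1 - surv j.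
Definition birth_mass (i : nat) : R :=
  if i is i'.+1 then expR (tau i) - expR (tau i') else expR (tau 0).
(** Intensity of a cell per unit of weight. The density [exp (t - u)] in birth time [t] and death
    time [u] factorizes when [i < j]; on the diagonal remains the mass [h] of all births in the slot
    minus those outliving it. Slot 0 has no diagonal term, as no death falls there. *)
Definition slot_mass (i j : nat) : R :=
  if (i < j)%N then birth_mass i * death_mass j
  else if (i == j) && (0 < i)%N then h - birth_mass i * expR (- tau i) else 0.

Lemma death_mass_ge0 j : 0 <= death_mass j.
Proof.
rewrite subr_ge0 /surv; case: ifPn => jm; last first.
  by case: ifP => // _; exact: expR_ge0.
have -> : (j.-1 <= m)%N by lia.
by rewrite ler_expR lerN2; apply: grid_time_homo; lia.
Qed.

Lemma inner_late i j t : (i < j)%N -> (j <= m.+1)%N -> t <= tau i ->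
  (\int[mu]_(s in [set s : R | (0 < s)%R /\ dset j ((t : R) + s)%R]) (expR (- s))%:E
     = (death_mass j * expR t)%:E)%E.
Proof.
case: j => // j; rewrite ltnS => ij; rewrite ltnS leq_eqVlt => jm ti.
have tj : t <= tau j by apply: le_trans ti _; exact: grid_time_homo.
case/predU1P : jm => [jE|jm].
  rewrite [X in integral _ X](_ : _ = `]tau m - t, +oo[%classic).
    rewrite integral_expRN_itvoy; congr EFin.
    by rewrite /death_mass /surv jE leqnn ltnn subr0 opprB addrC expRD.
  apply/seteqP; split => s; rewrite jE dset_last /= !in_itv /= !andbT; rewrite -jE; last first.
    by move=> h1; split; lra.
  by move=> [_ h1]; lra.
rewrite [X in integral _ X](_ : _ = `]tau j - t, tau j.+1 - t]%classic).
  rewrite integral_expRN_itvoc; last by rewrite lerD2r; apply: grid_time_homo.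
  congr EFin.
  by rewrite /death_mass /surv (ltnW jm) jm mulrBl !opprB [t - _]addrC [t - _]addrC !expRD.
apply/seteqP; split => s; rewrite dsetS //= !in_itv /=.
  by move=> [_ /andP[h1 h2]]; apply/andP; split; lra.
by move=> /andP[h1 h2]; split; first lra; apply/andP; split; lra.
Qed.

Lemma mass_late i j : (i < j)%N -> (j <= m.+1)%N ->
  (\int[mu]_(t in bset i) \int[mu]_(s in [set s : R | (0 < s)%R /\ dset j ((t : R) + s)%R])
     (expR (- s))%:E = (birth_mass i * death_mass j)%:E)%E.
Proof.
move=> ij jm.
transitivity (\int[mu]_(t in bset i) (0 + death_mass j * expR t)%:E)%E.
  by apply: eq_integral => t /set_mem /andP[_ ti]; rewrite add0r (inner_late ij).
case: i ij => [|i] ij.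
  rewrite bset0; under eq_integral do rewrite add0r.
  by rewrite integral_expR_itvNyc ?death_mass_ge0 // mulrC.
rewrite bsetS integral_affine_expR; last exact: grid_time_homo.
by rewrite mul0r add0r mulrC.
Qed.

Lemma mass_cell i j : (j <= m.+1)%N -> (i <= m)%N ->
  (\int[mu]_(t in bset i) \int[mu]_(s in [set s : R | (0 < s)%R /\ dset j ((t : R) + s)%R])
     (expR (- s))%:E = (slot_mass i j)%:E)%E.
Proof.
move=> jm im; rewrite /slot_mass; case: ifPn => [ij|]; first exact: mass_late.
rewrite -leqNgt => ji; case: ifPn => [/andP[/eqP e i0]|ne].
  subst j; case: i im {ji jm} i0 => // i im _.
  transitivity (\int[mu]_(t in bset i.+1) (1 + (- expR (- tau i.+1)) * expR t)%:E)%E.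
    apply: eq_integral => t /set_mem /andP[/= ti1 ti2].
    rewrite [X in integral _ X](_ : _ = `]0, tau i.+1 - t]%classic).
      rewrite integral_expRN_itvoc; last lra.
      by rewrite oppr0 expR0 opprB addrC expRD mulrC mulNr; congr EFin; ring.
    apply/seteqP; split => s; rewrite dsetS //= !in_itv /=.
      by move=> [h1 /andP[h2 h3]]; apply/andP; split; lra.
    by move=> /andP[h1 h2]; split => //; apply/andP; split; lra.
  rewrite bsetS integral_affine_expR; last exact: grid_time_homo.
  by congr EFin; rewrite /= /grid_time -natr1; ring.
rewrite (eq_integral (fun=> 0%E)) ?integral0 // => t /set_mem Bt.
rewrite [X in integral _ X](_ : _ = set0) ?integral_set0 //.
apply/seteqP; split => // s [s0]; rewrite /dset /= => /and3P[j0 _ /implyP jt].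
have ji' : (j < i)%N by rewrite ltn_neqAle ji andbT; apply: contra ne => /eqP <-; rewrite eqxx.
case: i im Bt ji' {ji ne} => // i im /andP[/= it _] ji.
have : tau j <= tau i by exact: grid_time_homo.
have jm2 : (j <= m)%N by lia.
by have := jt jm2; lra.
Qed.

Lemma mass_birth i : 
  (\int[mu]_(t in bset i.+1) \int[mu]_(s in [set s : R | (0 < s)%R /\ [set: R] ((t : R) + s)%R])
     (expR (- s))%:E = h%:E)%E.
Proof.
transitivity (\int[mu]_(t in bset i.+1) (1 + 0 * expR t)%:E)%E.
  apply: eq_integral => t _; rewrite [X in integral _ X](_ : _ = `]0, +oo[%classic).
    by rewrite integral_expRN_itvoy oppr0 expR0 mul0r addr0.
  by apply/seteqP; split => s /=; rewrite in_itv /= andbT // => -[].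
rewrite bsetS integral_affine_expR; last exact: grid_time_homo.
by congr EFin; rewrite /grid_time -natr1; ring.
Qed.

(** The free process is stationary: at any grid time the points alive have mass 1 per unit of
    weight, and a fraction [1 - exp (- h)] of them dies within the next slot. *)
Lemma mass_death i : (i < m)%N ->
  (\int[mu]_(t in `]-oo, tau i]) \int[mu]_(s in [set s : R | (0 < s)%R /\ dset i.+1 ((t : R) + s)%R])
     (expR (- s))%:E = (1 - expR (- h))%:E)%E.
Proof.
move=> im.
transitivity (\int[mu]_(t in `]-oo, tau i]) (death_mass i.+1 * expR t)%:E)%E.
  by apply: eq_integral => t /set_mem /=; rewrite in_itv /= => ti; rewrite (inner_late (ltnSn i)) // ltnW.
rewrite integral_expR_itvNyc ?death_mass_ge0 //; congr EFin.
rewrite /death_mass /surv /= (ltnW im) im mulrBl -!expRD addNr expR0.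
by congr (_ - expR _); rewrite /grid_time -natr1; ring.
Qed.

End Grid.

(** * Approximate stationarity *)

Section Weights.
Context {R : realType} {d : nat}.
Variables (n m : nat) (c : 'I_n -> pp_cyc d) (w : 'I_n -> R) (t0 h : R).
Hypothesis h0 : 0 <= h.
Hypothesis w0 : forall g, 0 <= w g.
Local Notation tau := (grid_time t0 h).
Local Notation dmass := (death_mass m t0 h).
Local Notation cell_mass := (slot_mass m t0 h).
Local Notation state := (state n m).
Local Notation letter := (letter n m).
Local Notation step := (step (m := m) c).
Local Notation run := (run (m := m) c).
Local Notation compat := (compat (m := m) c).
Local Notation inc := (inc c).

Definition total_weight : R := \sum_g w g.
Local Notation W := total_weight.

(** Law of the death slot of a point alive at [tau k]: a probability by [rho_sum], memoryless by
    [rhoS]. *)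
Definition rho (k j : nat) : R := if (k < j)%N then expR (tau k) * dmass j else 0.

(** A slot carries Poisson mass [W * h] in all: this is the probability that it contains no birth,
    or exactly one, in the given cell. *)
Definition letter_prob (i : nat) (x : letter) : R :=
  expR (- (W * h)) * if x is Some (g, j) then w g * cell_mass i j else 1.

(** Up to the factor [exp (- W)], the probability that the free process at [tau k] has exactly the
    points described by [z]. *)
Definition state_weight (k : nat) (z : state) : R :=
  \prod_g (if z g == ord0 then 1 else w g * rho k (z g)).

Definition admissible (z : state) : bool :=
  [forall g, (z g != ord0) ==> [forall g', (z g' != ord0) && (g' != g) ==> ~~ inc g g']].

(** Mass at [z'] after [k] slots, started from the hard-core initial law without normalization; each
    slot also loses the mass of two or more births. *)
Fixpoint path_weight (k : nat) (z' : state) : R :=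
  if k is k'.+1 then
    \sum_z \sum_x (step k z x == z')%:R * letter_prob k x * path_weight k' z
  else (admissible z')%:R * state_weight 0 z'.

Lemma rho_ge0 k j : 0 <= rho k j.
Proof. rewrite /rho; case: ifP => // _; apply: mulr_ge0; first exact: expR_ge0.
exact: death_mass_ge0. Qed.

Lemma tauS k : tau k.+1 = tau k + h.
Proof. by rewrite /grid_time -natr1; ring. Qed.

Lemma rhoS k j : (k.+1 < j)%N -> rho k j = expR (- h) * rho k.+1 j.
Proof.
move=> kj; rewrite /rho kj (ltnW kj) tauS mulrA; congr (_ * _).
by rewrite -expRD; congr expR; ring.
Qed.

Lemma rho_next k : (k < m)%N -> rho k k.+1 = 1 - expR (- h).
Proof.
move=> km; rewrite /rho ltnSn /death_mass /surv /= (ltnW km) km mulrBr -!expRD subrr expR0.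
by rewrite tauS; congr (_ - expR _); ring.
Qed.

Lemma rho_last : rho m m.+1 = 1.
Proof. by rewrite /rho ltnSn /death_mass /surv /= leqnn ltnn subr0 -expRD subrr expR0. Qed.

Lemma rho_sum k : (k <= m)%N -> \sum_(j < m.+2) rho k j = 1.
Proof.
move=> km; rewrite -(big_mkord xpredT (rho k)).
rewrite (big_cat_nat _ (n := k.+1)) //=; last lia.
rewrite big_nat big1 ?add0r; last first.
  by move=> i /andP[_ ik]; rewrite /rho ltnNge -ltnS ik.
rewrite big_nat (eq_bigr (fun j => expR (tau k) * dmass j)); last first.
  by move=> j /andP[kj _]; rewrite /rho kj.
rewrite -big_nat -mulr_sumr -{1}(addn1 k) -{1}(addn1 m.+1) big_addn addn1 subn1 /=.
rewrite (eq_bigr (fun j => - (surv m t0 h j.+1 - surv m t0 h j))); last first.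
  by move=> j _; rewrite /death_mass addn1 /= opprB.
rewrite sumrN telescope_sumr; last lia.
by rewrite /surv km ltnn sub0r opprK -expRD subrr expR0.
Qed.

Lemma cell_mass_late k j : (k.+1 < j)%N ->
  cell_mass k.+1 j = (1 - expR (- h)) * rho k.+1 j.
Proof.
move=> kj; rewrite /slot_mass /rho kj mulrA; congr (_ * _).
by rewrite /= mulrBl mul1r -expRD tauS; congr (_ - expR _); ring.
Qed.

Lemma one_sub_expRN : 0 <= 1 - expR (- h).
Proof. by rewrite subr_ge0 -expR0 ler_expR oppr_le0. Qed.

Lemma cell_mass_lb k j : (1 - expR (- h)) * rho k.+1 j <= cell_mass k.+1 j.
Proof.
have [kj|kj] := ltnP k.+1 j; first by rewrite cell_mass_late.
rewrite {1}/rho ltnNge kj mulr0 /slot_mass ltnNge kj /=; case: ifP => // _.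
rewrite mulrBl -!expRD subrr expR0 tauS.
have -> : tau k - (tau k + h) = - h by ring.
by have := @expR_ge1Dx R (- h); lra.
Qed.

Lemma cell_mass_ge0 i j : 0 <= cell_mass i j.
Proof.
case: i => [|i]; last first.
  by apply: le_trans (cell_mass_lb i j); rewrite mulr_ge0 ?rho_ge0 ?one_sub_expRN.
rewrite /slot_mass; case: ifP => _; last by rewrite andbF.
by apply: mulr_ge0; [exact: expR_ge0|exact: death_mass_ge0].
Qed.

Lemma letter_prob_ge0 i x : 0 <= letter_prob i x.
Proof.
rewrite mulr_ge0 ?expR_ge0 //; case: x => [[g j]|] //.
by rewrite mulr_ge0 ?cell_mass_ge0.
Qed.

Lemma state_weight_ge0 k z : 0 <= state_weight k z.
Proof. by apply: prodr_ge0 => g _; case: ifP => // _; rewrite mulr_ge0 ?rho_ge0. Qed.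

Lemma path_weight_ge0 k z : 0 <= path_weight k z.
Proof.
elim: k z => [|k IH] z /=; first by rewrite mulr_ge0 ?state_weight_ge0.
apply: sumr_ge0 => z' _; apply: sumr_ge0 => x _.
apply: mulr_ge0; last exact: IH.
by apply: mulr_ge0; [exact: ler0n|exact: letter_prob_ge0].
Qed.

(** By [exp (- a h) >= 1 - a h] and [1 - exp (- h) >= h (1 - h)], the right side is at least
    [(1 - a h) (1 + a h (1 - h))], which equals [1 - (a ^ 2 + a) h ^ 2 + a ^ 2 h ^ 3]. If [a h >= 1]
    the left side is already nonpositive. *)
Lemma expR_balance (a : R) : 0 <= a ->
  1 - (a ^+ 2 + a) * h ^+ 2 <= expR (- (a * h)) * (1 + a * (1 - expR (- h))).
Proof.
move=> a0; have h_ge0 := h0; have ah : 0 <= a * h by rewrite mulr_ge0.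
have e1 : h * (1 - h) <= 1 - expR (- h).
  have := @expR_ge1Dx R h; rewrite expRN => e.
  have eh : (expR h)^-1 <= (1 + h)^-1.
    by rewrite lef_pV2 ?posrE ?expR_gt0 //; lra.
  have : (1 + h)^-1 <= 1 - h * (1 - h).
    rewrite -div1r ler_pdivrMr; last lra.
    have h3 : 0 <= h ^+ 3 by rewrite exprn_ge0.
    nra.
  by lra.
have [ah1|ah1] := leP 1 (a * h).
  apply: le_trans (_ : 0 <= _); last first.
    by rewrite mulr_ge0 ?expR_ge0 // addr_ge0 // mulr_ge0 // one_sub_expRN.
  have : 1 <= (a * h) ^+ 2 by rewrite exprn_ege1.
  have : 0 <= a * h ^+ 2 by rewrite mulr_ge0 // exprn_ge0.
  by rewrite exprMn; lra.
have e2 := @expR_ge1Dx R (- (a * h)).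
have u0 := one_sub_expRN.
apply: le_trans (_ : (1 - a * h) * (1 + a * (1 - expR (- h))) <= _); last first.
  by apply: ler_wpM2r; [rewrite addr_ge0 // mulr_ge0|lra].
apply: le_trans (_ : (1 - a * h) * (1 + a * (h * (1 - h))) <= _); last first.
  by apply: ler_wpM2l; [lra|rewrite lerD2l ler_wpM2l].
have : 0 <= a ^+ 2 * h ^+ 3 by rewrite mulr_ge0 // exprn_ge0.
by lra.
Qed.

Lemma ler_sum_inj (I J : finType) (Q : pred I) (F : J -> R) (f : I -> J) (j0 : J) :
  (forall j, 0 <= F j) -> {in Q &, injective f} -> (forall i, Q i -> f i != j0) ->
  F j0 + \sum_(i | Q i) F (f i) <= \sum_j F j.
Proof.
move=> F0 fI fN; rewrite (bigD1 j0) //= lerD2l.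
have -> : \sum_(i | Q i) F (f i) = \sum_(j in f @: Q) F j by rewrite big_imset.
rewrite [leLHS]big_mkcond [leRHS]big_mkcond; apply: ler_sum => j _.
case: ifPn => [/imsetP[i Qi ->]|_]; last by case: ifP.
by rewrite fN.
Qed.

(** With [i] the current slot, these are the predecessors of [z] retained besides [z] itself: an
    occupied [g] is yet to be born, a vacant [g] was present and dies in slot [i]. *)
Definition toggle (i : 'I_m.+2) (z : state) (g : 'I_n) : state :=
  [ffun g' => if g' == g then if z g == ord0 then i else ord0 else z g'].

Lemma toggle_inj i z : i != ord0 -> injective (toggle i z).
Proof.
move=> i0 g g' /ffunP/(_ g); rewrite !ffunE eqxx; have [//|_] := eqVneq g g'.
by have [->|ne] := eqVneq (z g) ord0 => /eqP; rewrite ?(negPf i0) // eq_sym (negPf ne).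
Qed.

Lemma toggle_neq i z g : i != ord0 -> toggle i z g != z.
Proof.
move=> i0; apply/eqP => /ffunP/(_ g); rewrite ffunE eqxx.
by have [->|ne] := eqVneq (z g) ord0 => /eqP; rewrite ?(negPf i0) // eq_sym (negPf ne).
Qed.

Lemma admissibleP (z : state) :
  reflect (forall g g', z g != ord0 -> z g' != ord0 -> g' != g -> ~~ inc g g') (admissible z).
Proof.
apply: (iffP forallP) => [A g g' zg zg' gg'|A g].
  by have /implyP/(_ zg)/forallP/(_ g')/implyP := A g; apply; rewrite zg'.
by apply/implyP => zg; apply/forallP => g'; apply/implyP => /andP[]; exact: (A g g' zg).
Qed.

Lemma inc_sym g g' : inc g g' = inc g' g.
Proof. by apply/incE/incE => /incompat_sym. Qed.

(** The constant of [expR_balance] at [a = W + n], a bound for the total rate of births and deaths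
    in any state. *)
Definition balance_rate : R := (W + n%:R) ^+ 2 + (W + n%:R).

Lemma total_weight_ge0 : 0 <= W.
Proof. by apply: sumr_ge0 => g _; exact: w0. Qed.

Lemma balance_rate_ge0 : 0 <= balance_rate.
Proof.
have := total_weight_ge0 => Wn.
by apply: addr_ge0; [apply: exprn_ge0|]; apply: addr_ge0.
Qed.

(* Besides staying put, the chain reaches [z'] by the birth of a cycle occupied in
   [z'] or by the death of one compatible with [z']: up to [O(h^2)] these two
   contributions make up for the births and deaths leaving [z']. *)
Lemma step_balance k z' : (k < m)%N -> admissible z' ->
  (1 - balance_rate * h ^+ 2) * state_weight k.+1 z' <=
  \sum_z \sum_x (step k.+1 z x == z')%:R * letter_prob k.+1 x *
     ((admissible z)%:R * state_weight k z).
Proof.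
move=> km az'; set i := k.+1.
pose F z := \sum_x (step i z x == z')%:R * letter_prob i x *
   ((admissible z)%:R * state_weight k z).
have T0 z x : 0 <= (step i z x == z')%:R * letter_prob i x *
   ((admissible z)%:R * state_weight k z).
  apply: mulr_ge0; apply: mulr_ge0; do ?exact: ler0n.
    exact: letter_prob_ge0.
  exact: state_weight_ge0.
have F0 z : 0 <= F z by apply: sumr_ge0 => x _; exact: T0.
have F1 z x : (step i z x == z')%:R * letter_prob i x *
   ((admissible z)%:R * state_weight k z) <= F z.
  by rewrite /F (bigD1 x) //= lerDl; apply: sumr_ge0 => y _; exact: T0.
(* An occupied cycle due to die by slot [i] makes the left side vanish. *)
have [/forallP late|/forallPn[g]] := boolP [forall g, (z' g != ord0) ==> (i < z' g)%N]; last first.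
  rewrite negb_imply => /andP[zg zgi].
  rewrite [state_weight _ _](bigD1 g) //= (negPf zg) /rho (negPf zgi) mulr0 mul0r mulr0.
  by apply: sumr_ge0 => z _; exact: F0.
have im2 : (i < m.+2)%N by rewrite /i; lia.
pose io : 'I_m.+2 := Ordinal im2.
have io0 : io != ord0 by [].
pose Q g := (z' g != ord0) || compat z' g.
pose u := 1 - expR (- h).
have u0 : 0 <= u := one_sub_expRN.
pose a := expR (- (W * h)).
have a0 : 0 <= a by exact: expR_ge0.
pose b := state_weight k z'.
have b0 : 0 <= b by exact: state_weight_ge0.
have zi g : (if z' g == i :> nat then ord0 else z' g) = z' g.
  case: eqP => // zgi; have := late g; rewrite zgi ltnn implybF negbK => /eqP zg0.
  by move: zgi; rewrite zg0.
have rhoz g : z' g != ord0 -> rho k (z' g) = expR (- h) * rho i (z' g).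
  by move=> zg; apply: rhoS; have := late g; rewrite zg.
(* The state is unchanged when nothing is born or when the only birth is refused; [rho_sum] sums out
   the death slot of the latter. *)
have stay : a * b * (1 + u * \sum_(g | ~~ compat z' g) w g) <= F z'.
  rewrite /F; pose G (x : letter) := (step i z' x == z')%:R * letter_prob i x *
   ((admissible z')%:R * state_weight k z').
  have GN : G None = a * b.
    rewrite /G az' mul1r /letter_prob mulr1; have -> : step i z' None = z'.
      by apply/ffunP => g; rewrite ffunE.
    by rewrite eqxx mul1r.
  have GS g (j : 'I_m.+2) : ~~ compat z' g -> a * b * (u * (w g * rho i j)) <= G (Some (g, j)).
    move=> cg; rewrite /G az' mul1r /letter_prob; have -> : step i z' (Some (g, j)) = z'.
      by apply/ffunP => g'; rewrite ffunE (negPf cg) !andbF zi.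
    rewrite eqxx mul1r -/b [leRHS]mulrAC -/a; apply: ler_wpM2l; first exact: mulr_ge0.
    by rewrite mulrCA; apply: ler_wpM2l => //; exact: cell_mass_lb.
  rewrite mulrDr mulr1 -{1}GN (bigD1 (None : letter)) //= lerD2l -/(G _).
  rewrite mulr_sumr mulr_sumr.
  apply: le_trans (_ : \sum_(g | ~~ compat z' g) \sum_(j < m.+2) G (Some (g, j)) <= _).
    apply: ler_sum => g cg; rewrite -[w g]mulr1 -(rho_sum (k := i)) ?mulr_sumr; last by rewrite /i.
    by apply: ler_sum => j _; exact: GS.
  rewrite pair_big_dep /=.
  pose f (p : 'I_n * 'I_m.+2) : letter := Some p.
  have finj : {in (fun p : 'I_n * 'I_m.+2 => ~~ compat z' p.1 && true) &, injective f}.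
    by move=> p q _ _ [].
  have := @ler_sum_inj _ _ _ G f None (fun x => T0 z' x) finj (fun _ _ => isT).
  rewrite (bigD1 (None : letter)) //= -/(G None) lerD2l.
  by apply: le_trans; rewrite le_eqVlt; apply/orP; left; apply/eqP/eq_bigr => -[].
(* Relative to [a * b], the death of a vacant compatible [g] weighs [u * w g], and the birth of an
   occupied [g] at least [u]. *)
have swap g : Q g -> a * b * (u * (if z' g == ord0 then w g else 1)) <= F (toggle io z' g).
  rewrite /Q; case: (eqVneq (z' g) ord0) => zg /= cg.
    have tg : toggle io z' g g = io by rewrite ffunE eqxx zg.
    have to g' : g' != g -> toggle io z' g g' = z' g' by move=> ne; rewrite ffunE (negPf ne).
    apply: le_trans (F1 _ None).
    have -> : step i (toggle io z' g) None = z'.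
      apply/ffunP => g'; rewrite ffunE; have [->|ne] := eqVneq g' g.
        by rewrite tg /= eqxx zg.
      by rewrite to // zi.
    have -> : admissible (toggle io z' g).
      have half x : x != g -> z' x != ord0 -> ~~ inc x g.
        by move=> _ zx; move: cg => /forallP/(_ x); rewrite zx.
      apply/admissibleP => x y; have [->|xg] := eqVneq x g; have [->|yg] := eqVneq y g.
      - by [].
      - by rewrite (to y yg) => _ zy _; rewrite inc_sym; exact: half.
      - by rewrite (to x xg) => zx _ _; exact: half.
      - by rewrite (to x xg) (to y yg); exact: (admissibleP _ az').
    rewrite eqxx !mul1r /letter_prob mulr1 -/a -mulrA ler_wpM2l //.
    have -> : state_weight k (toggle io z' g) = w g * u * b.
      rewrite /b /state_weight (bigD1 g) //= [in RHS](bigD1 g) //= tg (negPf io0) zg eqxx mul1r.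
      rewrite /io /= rho_next //; congr (_ * _).
      by apply: eq_bigr => g' ne; rewrite to.
    by rewrite mulrC [u * _]mulrC.
  have tg : toggle io z' g g = ord0 by rewrite ffunE eqxx (negPf zg).
  have to g' : g' != g -> toggle io z' g g' = z' g' by move=> ne; rewrite ffunE (negPf ne).
  apply: le_trans (F1 _ (Some (g, z' g))).
  have late_g : (i < z' g)%N by have := late g; rewrite zg.
  have -> : step i (toggle io z' g) (Some (g, z' g)) = z'.
    have cz : compat (toggle io z' g) g.
      apply/forallP => g'; apply/implyP; have [->|ne] := eqVneq g' g; first by rewrite tg.
      by rewrite to // => zg'; apply: (admissibleP _ az') => //; rewrite eq_sym.
    apply/ffunP => g'; rewrite ffunE cz late_g !andbT.
    by have [->//|ne] := eqVneq g' g; rewrite to // zi.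
  have -> : admissible (toggle io z' g).
    apply/admissibleP => x y; have [->|xg] := eqVneq x g; first by rewrite tg eqxx.
    have [->|yg] := eqVneq y g; first by rewrite tg.
    by rewrite (to x xg) (to y yg); exact: (admissibleP _ az').
  rewrite eqxx !mul1r mulr1 /letter_prob -/a cell_mass_late // -/u -!mulrA ler_wpM2l //.
  have -> : b = w g * (expR (- h) * rho i (z' g)) * state_weight k (toggle io z' g).
    rewrite /b /state_weight (bigD1 g) //= [in RHS](bigD1 g) //= tg eqxx mul1r (negPf zg) rhoz //.
    by congr (_ * _); apply: eq_bigr => g' ne; rewrite to.
  set s := state_weight _ _; have s0 : 0 <= s by exact: state_weight_ge0.
  have -> : w g * (expR (- h) * rho i (z' g)) * s * u =
     expR (- h) * (w g * (u * (rho i (z' g) * s))) by ring.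
  rewrite ler_piMl //; first by rewrite !mulr_ge0 ?rho_ge0.
  by move: u0; rewrite subr_ge0.
have -> : \sum_z \sum_x (step i z x == z')%:R * letter_prob i x *
     ((admissible z)%:R * state_weight k z) = \sum_z F z by [].
have := @ler_sum_inj _ _ Q F (toggle io z') z' F0 (in2W (toggle_inj (z := z') io0))
   (fun g _ => toggle_neq z' g io0).
apply: le_trans.
have swaps : a * b * (u * \sum_(g | Q g) (if z' g == ord0 then w g else 1)) <=
    \sum_(g | Q g) F (toggle io z' g).
  by rewrite mulr_sumr mulr_sumr; apply: ler_sum.
apply: le_trans (lerD stay swaps).
rewrite -mulrDr -addrA -mulrDr.
set N : R := #|occupied z'|%:R.
(* Refused births and deaths together contribute every [w g] once; accepted births contribute 1 per
   occupied cycle. *)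
have -> : \sum_(g | ~~ compat z' g) w g + \sum_(g | Q g) (if z' g == ord0 then w g else 1) = W + N.
  have cz g : compat z' g -> z' g = ord0.
    move=> /forallP/(_ g); rewrite inc_refl implybF negbK; by move/eqP.
  rewrite /total_weight [in RHS](bigID (compat z')) /= [RHS]addrAC [RHS]addrC; congr (_ + _).
  rewrite (bigID (compat z')) /=; congr (_ + _).
    apply: eq_big => [g|g /andP[_ /cz ->]]; last by rewrite eqxx.
    by rewrite /Q; case: (compat z' g); rewrite ?andbF ?orbT.
  rewrite (eq_big (fun g => g \in occupied z') (fun=> 1)); last 2 first.
  - move=> g; rewrite /Q inE; case cg : (compat z' g); last by rewrite orbF andbT.
    by rewrite andbF cz // eqxx.
  - by move=> g /andP[+ ncg]; rewrite /Q (negPf ncg) orbF => /negPf ->.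
  by rewrite sumr_const.
(* Each of the [N] occupied cycles has to survive the slot. *)
have -> : b = expR (- (N * h)) * state_weight i z'.
  rewrite /b /N /state_weight -sum1_card natr_sum mulr_suml -sumrN expR_sum.
  rewrite [X in X * _]big_mkcond -big_split /=; apply: eq_bigr => g _; rewrite inE.
  case: eqVneq => zg /=; first by rewrite mul1r.
  by rewrite rhoz // mul1r; ring.
have -> : a * (expR (- (N * h)) * state_weight i z') * (1 + u * (W + N)) =
  (expR (- ((W + N) * h)) * (1 + (W + N) * u)) * state_weight i z'.
  have -> : expR (- ((W + N) * h)) = a * expR (- (N * h)).
    by rewrite /a -expRD; congr expR; ring.
  ring.
rewrite ler_wpM2r ?state_weight_ge0 //.
have Wn := total_weight_ge0.
have N0 : 0 <= N by exact: ler0n.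
have Nn : N <= n%:R by rewrite /N ler_nat -[leqRHS]card_ord max_card.
have WN0 : 0 <= W + N by exact: addr_ge0.
apply: le_trans (expR_balance WN0).
rewrite lerD2l lerN2 ler_wpM2r ?exprn_ge0 //.
have WNn : W + N <= W + n%:R by rewrite lerD2l.
by rewrite lerD // lerXn2r // nnegrE // (le_trans WN0).
Qed.

(** The errors add up by [(1 - k e) (1 - e) >= 1 - (k + 1) e]; the assumption on [m] keeps the first
    factor nonnegative. *)
Lemma path_weight_lb k z : (k <= m)%N -> m%:R * (balance_rate * h ^+ 2) <= 1 ->
  admissible z ->
  (1 - k%:R * (balance_rate * h ^+ 2)) * state_weight k z <= path_weight k z.
Proof.
move=> + hm; set e := balance_rate * h ^+ 2.
have e0 : 0 <= e by rewrite mulr_ge0 ?balance_rate_ge0 ?exprn_ge0.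
elim: k z => [|k IH] z km az; first by rewrite mul0r subr0 mul1r /= az mul1r.
have ke : 0 <= 1 - k%:R * e.
  rewrite subr_ge0; apply: le_trans hm; rewrite ler_wpM2r // ler_nat; exact: ltnW.
apply: le_trans (_ : (1 - k%:R * e) * ((1 - e) * state_weight k.+1 z) <= _).
  rewrite mulrA ler_wpM2r ?state_weight_ge0 //.
  have -> : (1 - k%:R * e) * (1 - e) = 1 - k.+1%:R * e + k%:R * e ^+ 2.
    by rewrite -natr1; ring.
  by rewrite lerDl mulr_ge0 // exprn_ge0.
apply: le_trans (ler_wpM2l ke (step_balance km az)) _.
rewrite mulr_sumr /=; apply: ler_sum => z' _; rewrite mulr_sumr; apply: ler_sum => x _.
rewrite mulrCA ler_wpM2l //; first by apply: mulr_ge0; [exact: ler0n|exact: letter_prob_ge0].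
have [az'|_] := boolP (admissible z'); last by rewrite mul0r mulr0 path_weight_ge0.
by rewrite mul1r; apply: IH => //; exact: ltnW.
Qed.

Fixpoint word_prob (s : seq letter) : R :=
  if s is x :: s' then letter_prob (size s').+1 x * word_prob s' else 1.

(** Unrolls the recursion so that, for [k = m], each term is up to [exp (- W)] the probability of an
    [atom_event]. *)
Lemma path_weightE k z : path_weight k z =
  \sum_z0 \sum_(s : k.-tuple letter)
    (run z0 s == z)%:R * word_prob s * ((admissible z0)%:R * state_weight 0 z0).
Proof.
elim: k z => [|k IH] z /=.
  rewrite (bigD1 z) //= [X in _ + X]big1 ?addr0; last first.
    move=> z0 nz; rewrite big1 // => s _; rewrite tuple0 /= (negPf nz).
    by rewrite !mul0r.
  rewrite (big_pred1 [tuple]) => [|s]; last by apply/esym/eqP; exact: tuple0.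
  by rewrite /= eqxx !mul1r.
under [RHS]eq_bigr => z0 _.
  rewrite (reindex (fun p : letter * k.-tuple letter => cons_tuple p.1 p.2)) /=; last first.
    exists (fun t => (thead t, [tuple of behead t])) => [[x t] _|t _].
      by rewrite theadE; congr pair; apply: val_inj.
    by rewrite /= [RHS]tuple_eta.
  over.
rewrite /=.
under eq_bigr => z1 _ do under eq_bigr => x _ do rewrite IH mulr_sumr.
under eq_bigr => z1 _ do rewrite exchange_big.
rewrite exchange_big /=; apply: eq_bigr => z0 _.
rewrite -(pair_big xpredT xpredT (fun x (s : k.-tuple letter) =>
   (step (size s).+1 (run z0 s) x == z)%:R * (letter_prob (size s).+1 x * word_prob s) *
     ((admissible z0)%:R * state_weight 0 z0))) /=.
rewrite exchange_big /=; apply: eq_bigr => x _.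
under eq_bigr do rewrite mulr_sumr.
rewrite exchange_big /=; apply: eq_bigr => s _.
rewrite (bigD1 (run z0 s)) //= eqxx big1 ?addr0; last first.
  by move=> z1 nz; rewrite [run z0 s == _]eq_sym (negPf nz) !mul0r mulr0.
by rewrite size_tuple mul1r -!mulrA.
Qed.

End Weights.

(** * Probability of the slot counts *)

Lemma poisson_prod (R : realType) (X : finType) (l : X -> R) (b : X -> bool) :
  \prod_x pp_poisson_p (l x) (b x) = expR (- \sum_x l x) * \prod_(x | b x) l x.
Proof.
rewrite [X in _ * X]big_mkcond /= -sumrN expR_sum -big_split /=; apply: eq_bigr => x _.
by rewrite /pp_poisson_p; case: (b x); rewrite /= ?expr1 ?expr0 ?divr1 ?mul1r ?mulr1 // mulrC.
Qed.

Section FiniteMeasure.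
Context {R : realType} {dd : measure_display} {Om : measurableType dd}.
Variable P : probability Om R.

Definition Pr (A : set Om) : R := fine (P A).

Lemma PrE A : measurable A -> P A = (Pr A)%:E.
Proof. by move=> mA; rewrite fineK // fin_num_measure. Qed.

Lemma Pr_ge0 A : 0 <= Pr A.
Proof. exact: fine_ge0. Qed.

Lemma Pr_le A B : measurable A -> measurable B -> A `<=` B -> Pr A <= Pr B.
Proof. move=> mA mB AB; rewrite -lee_fin -!PrE //.
exact: (le_measure P (mem_set mA) (mem_set mB) AB).
Qed.

Lemma PrT : Pr setT = 1.
Proof. by rewrite /Pr probability_setT. Qed.

Lemma Pr_le1 A : measurable A -> Pr A <= 1.
Proof. by move=> mA; rewrite -PrT; exact: Pr_le. Qed.

Lemma PrU_le A B : measurable A -> measurable B -> Pr (A `|` B) <= Pr A + Pr B.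
Proof.
move=> mA mB; have : (P (A `|` B) <= P A + P B)%E by exact: measureU2.
by rewrite !PrE //; exact: measurableU.
Qed.

Lemma PrU A B : measurable A -> measurable B ->
  Pr (A `|` B) = Pr A + Pr B - Pr (A `&` B).
Proof.
move=> mA mB; apply: EFin_inj; rewrite EFinB EFinD -!PrE //; last 2 first.
- exact: measurableI.
- exact: measurableU.
by apply: measureUfinl => //; exact: le_lt_trans (probability_le1 P mA) (ltry _).
Qed.

Lemma Pr_setC A : measurable A -> Pr (~` A) = 1 - Pr A.
Proof. by move=> mA; rewrite /Pr probability_setC // PrE. Qed.

Lemma measurable_finU (I : finType) (Q : pred I) (F : I -> set Om) :
  (forall i, measurable (F i)) -> measurable (\bigcup_(i in [set i | Q i]) F i).
Proof. by move=> mF; apply: fin_bigcup_measurable => // i _; exact: mF. Qed.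

Lemma Pr_finU (I : finType) (Q : pred I) (F : I -> set Om) :
  (forall i, measurable (F i)) -> (forall i j, i != j -> F i `&` F j = set0) ->
  Pr (\bigcup_(i in [set i | Q i]) F i) = \sum_(i | Q i) Pr (F i).
Proof.
move=> mF dF; apply: EFin_inj; rewrite -PrE; last exact: measurable_finU.
have -> : [set i | Q i] = [set` enum Q].
  by apply/seteqP; split => i /=; rewrite mem_enum.
rewrite measure_fin_bigcup //; last first.
  move=> i j _ _ [x xij]; apply/eqP/negPn/negP => /dF e.
  by move: xij; rewrite e.
rewrite -fsbig_seq ?enum_uniq // -big_enum /=.
by rewrite -sumEFin; apply: eq_bigr => i _; rewrite PrE.
Qed.

Lemma Pr_finU_le (I : finType) (Q : pred I) (F : I -> set Om) :
  (forall i, measurable (F i)) ->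
  Pr (\bigcup_(i in [set i | Q i]) F i) <= \sum_(i | Q i) Pr (F i).
Proof.
move=> mF.
have -> : \bigcup_(i in [set i | Q i]) F i = \big[setU/set0]_(i | Q i) F i.
  by rewrite -bigcup_pred.
suff [] : measurable (\big[setU/set0]_(i | Q i) F i) /\
  Pr (\big[setU/set0]_(i | Q i) F i) <= \sum_(i | Q i) Pr (F i) by [].
apply: (big_rec2 (fun A x => measurable A /\ Pr A <= x)) => [|i x A Qi [mA Ax]].
  by split => //; rewrite /Pr measure0.
split; first exact: measurableU.
by apply: le_trans (PrU_le (mF i) mA) _; rewrite lerD2l.
Qed.

(** Continuity from above: the tail unions decrease to the upper limit, and each contains the
    corresponding [F n]. *)
Lemma Pr_lim_sup (F : (set Om)^nat) (a : R) : (forall n, measurable (F n)) ->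
  (forall e, 0 < e -> exists n0, forall n, (n0 <= n)%N -> a - e <= Pr (F n)) ->
  a <= Pr (lim_sup_set F).
Proof.
move=> mF lb; have mU n : measurable (\bigcup_(k in [set k | (n <= k)%N]) F k).
  by apply: bigcup_measurable => k _.
have mL : measurable (lim_sup_set F) by apply: bigcap_measurable.
rewrite -lee_fin -PrE //.
have cv : P (\bigcup_(k in [set k | (n <= k)%N]) F k) @[n --> \oo] --> P (lim_sup_set F).
  by apply: lim_sup_set_cvg => //; apply: le_lt_trans (probability_le1 P (mU 0%N)) (ltry _).
apply/lee_addgt0Pr => e e0; have [n0 n0P] := lb e e0.
rewrite -leeBlDr // -(cvg_lim _ cv) //; apply: lime_ge; first by apply/cvg_ex; eexists; exact: cv.
near=> n; rewrite PrE // lee_fin; apply: le_trans (n0P n _) _.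
  by near: n; exists n0.
by apply: Pr_le => // x Fx; exists n => /=.
Unshelve. all: by end_near. Qed.

End FiniteMeasure.

Section FinitePPP.
Context {R : realType} {d : nat} {dd : measure_display} {Om : measurableType dd}.
Variables (alpha : R) (V : pp_site d -> \bar R) (P : probability Om R).
Variable N : Om -> set (pp_gpoint R d).
Hypothesis NP : pp_is_PPP alpha V P N.

Definition count_event (A : set (pp_gpoint R d)) (k : nat) : set Om :=
  [set om | pp_count (N om) A = (k%:R)%:E].

Lemma ppp_finite (C : finType) (A : C -> set (pp_gpoint R d)) (k : C -> nat) (l : C -> R) :
  (forall i, pp_pmeasurable (A i)) -> (forall i, pp_intensity alpha V (A i) = (l i)%:E) ->
  (forall i j, i != j -> A i `&` A j = set0) ->
  let E := \bigcap_(i in [set: C]) count_event (A i) (k i) in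
  measurable E /\ Pr P E = \prod_i pp_poisson_p (l i) (k i).
Proof.
move=> mA lA dA /=.
have [|i|i j ij|mE PE] := @NP #|C| (A \o enum_val) (k \o enum_val).
- by move=> i; exact: mA.
- by rewrite /= lA ltry.
- by apply: dA; rewrite (inj_eq enum_val_inj).
have -> : \bigcap_(i in [set: C]) count_event (A i) (k i) =
    \bigcap_(i in [set: 'I_#|C|]) count_event (A (enum_val i)) (k (enum_val i)).
  apply/seteqP; split => om h i _; first exact: h.
  by rewrite -(enum_rankK i); exact: h.
split => //; rewrite /Pr [X in fine X]PE /=.
rewrite (reindex (@enum_val C predT)) /=; last first.
  by exists enum_rank => x _; [exact: enum_valK|exact: enum_rankK].
by apply: eq_bigr => i _; rewrite lA.
Qed.

Lemma ppp_single (A : set (pp_gpoint R d)) (k : nat) (l : R) :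
  pp_pmeasurable A -> pp_intensity alpha V A = l%:E ->
  measurable (count_event A k) /\ Pr P (count_event A k) = pp_poisson_p l k.
Proof.
move=> mA lA.
have [//|//|i j|] := @ppp_finite unit (fun=> A) (fun=> k) (fun=> l).
  by case: i j => -[]; rewrite eqxx.
have -> : \bigcap_(i in [set: unit]) count_event A k = count_event A k.
  by apply/seteqP; split => om h //; exact: (h tt).
by rewrite (big_pred1 tt) // => -[].
Qed.

(** Inclusion and exclusion gives the product [(1 - exp (- a)) (1 - exp (- b))]. *)
Lemma ppp_clash (A B : set (pp_gpoint R d)) (a b : R) :
  pp_pmeasurable A -> pp_intensity alpha V A = a%:E -> 0 <= a ->
  pp_pmeasurable B -> pp_intensity alpha V B = b%:E -> 0 <= b -> A `&` B = set0 ->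
  let E := ~` count_event A 0 `&` ~` count_event B 0 in
  measurable E /\ Pr P E <= a * b.
Proof.
move=> mA lA a0 mB lB b0 AB /=.
have [mEA PA] := ppp_single 0 mA lA; have [mEB PB] := ppp_single 0 mB lB.
have [|i|i j|] := @ppp_finite bool (fun i => if i then A else B) (fun=> 0%N)
  (fun i => if i then a else b); try by case: i.
- by case.
- by case: i j => -[] // _; rewrite setIC.
have -> : \bigcap_(i in [set: bool]) count_event (if i then A else B) 0 =
    count_event A 0 `&` count_event B 0.
  apply/seteqP; split => om h; first by split; [exact: (h true)|exact: (h false)].
  by case=> _; case: h.
move=> mE; rewrite big_bool /= => PAB.
rewrite -setCU; split; first by apply/measurableC/measurableU.
rewrite Pr_setC; last exact: measurableU.
rewrite PrU // PA PB PAB /pp_poisson_p !expr0 fact0 !divr1 !mul1r.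
have ea : 1 - expR (- a) <= a by have := @expR_ge1Dx R (- a); lra.
have eb : 1 - expR (- b) <= b by have := @expR_ge1Dx R (- b); lra.
apply: le_trans (ler_pM (one_sub_expRN a0) (one_sub_expRN b0) ea eb).
by rewrite le_eqVlt; apply/orP; left; apply/eqP; ring.
Qed.

End FinitePPP.

(** * Probabilities of initial states and words *)

Section Atoms.
Context {R : realType} {d : nat} {dd : measure_display} {Om : measurableType dd}.
Variables (alpha : R) (V : pp_site d -> \bar R) (P : probability Om R).
Variable N : Om -> set (pp_gpoint R d).
Hypothesis alpha0 : 0 < alpha.
Hypothesis V0 : forall z, (0 <= V z)%E.
Hypothesis NP : pp_is_PPP alpha V P N.
Variables (n m : nat) (c : 'I_n -> pp_cyc d) (t0 h : R).
Hypothesis c_inj : injective c.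
Hypothesis h0 : 0 <= h.

Local Notation w := (fun g => weight alpha V (c g)).
Local Notation tau := (grid_time t0 h).
Local Notation cell := (cell m c tau).
Local Notation cell_mass := (slot_mass m t0 h).
Local Notation state := (state n m).
Local Notation letter := (letter n m).
Local Notation run := (run (m := m) c).
Local Notation W := (total_weight w).
Local Notation letter_prob := (letter_prob (m := m) w t0 h).
Local Notation word_prob := (word_prob (m := m) w t0 h).
Local Notation state_weight := (state_weight w t0 h).

Let w0 g : 0 <= w g. Proof. exact: weight_ge0. Qed.

Lemma cell_pmeasurable g i j : (j <= m.+1)%N -> pp_pmeasurable (cell g i j).
Proof.
by move=> jm; exact: (box_pmeasurable (c g) (bset_measurable t0 h i) (dset_measurable _ _ jm)).
Qed.

Lemma cell_intensity g i j : (i <= m)%N -> (j <= m.+1)%N ->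
  pp_intensity alpha V (cell g i j) = (w g * cell_mass i j)%:E.
Proof. by move=> im jm; exact: (intensity_box alpha0 V0 (c g) (mass_cell t0 h0 jm im)). Qed.

Lemma birth_slot_inj i j x : birth_slot tau i x -> birth_slot tau j x -> i = j.
Proof.
have lt a b : (a < b)%N -> birth_slot tau a x -> birth_slot tau b x -> False.
  case: b => // b ab /andP[_ xa] /andP[/= bx _].
  by have : tau a <= tau b by [exact: grid_time_homo]; lra.
move=> xi xj; have [ij|ij|//] := ltngtP i j; exfalso.
  exact: lt ij xi xj.
exact: lt ij xj xi.
Qed.

Lemma death_slot_inj i j x : (i <= m.+1)%N -> (j <= m.+1)%N ->
  death_slot m tau i x -> death_slot m tau j x -> i = j.
Proof.
have lt a b : (b <= m.+1)%N -> (a < b)%N ->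
    death_slot m tau a x -> death_slot m tau b x -> False.
  case: b => // b bm ab /and3P[_ _ /implyP xa] /and3P[_ /= bx _].
  have am : (a <= m)%N by lia.
  by have : tau a <= tau b by [exact: grid_time_homo]; have := xa am; lra.
move=> im jm xi xj; have [ij|ij|//] := ltngtP i j; exfalso.
  exact: lt ij xi xj.
exact: lt ij xj xi.
Qed.

Lemma cell_disjoint (i i' : nat) (x x' : 'I_n * 'I_m.+2) : (i, x) != (i', x') ->
  cell x.1 i x.2 `&` cell x'.1 i' x'.2 = set0.
Proof.
move=> ne; apply/seteqP; split => // p [[/= e _ b dt] [/= e' _ b' dt']].
move/eqP: ne; apply; rewrite (birth_slot_inj b b'); congr (_, _).
rewrite [x]surjective_pairing [x']surjective_pairing; congr (_, _).
  by apply: c_inj; rewrite -e.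
by apply/val_inj/(death_slot_inj _ _ dt dt'); rewrite -ltnS ltn_ord.
Qed.

Lemma cell_mass_sum k : (k < m)%N -> \sum_(j < m.+2) cell_mass k.+1 j = h.
Proof.
move=> km; set u := 1 - expR (- h).
have im2 : (k.+1 < m.+2)%N by lia.
rewrite (eq_bigr (fun j : 'I_m.+2 => u * rho m t0 h k.+1 j +
    if j == Ordinal im2 then h - u else 0)).
  by rewrite big_split /= -mulr_sumr rho_sum // mulr1 -big_mkcond big_pred1_eq addrC subrK.
move=> j _; rewrite -val_eqE /=; have [kj|kj] := ltnP k.+1 j.
  by rewrite cell_mass_late // gtn_eqF // addr0.
rewrite /rho ltnNge kj mulr0 add0r /slot_mass ltnNge kj /= andbT.
have [_|//] := eqVneq k.+1 (j : nat).
rewrite /u mulrBl -!expRD subrr expR0 tauS.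
by have -> : tau k - (tau k + h) = - h by ring.
Qed.

Lemma cell_mass0 j : cell_mass 0 j = rho m t0 h 0 j.
Proof. by rewrite /slot_mass /rho andbF. Qed.

Lemma slot_prob k (a : letter) : (k < m)%N ->
  \prod_(x : 'I_n * 'I_m.+2) pp_poisson_p (w x.1 * cell_mass k.+1 x.2) (a == Some x)
    = letter_prob k.+1 a.
Proof.
move=> km; rewrite poisson_prod.
have -> : \sum_(x : 'I_n * 'I_m.+2) w x.1 * cell_mass k.+1 x.2 = W * h.
  rewrite -(pair_bigA _ (fun g (j : 'I_m.+2) => w g * cell_mass k.+1 j)) /=.
  rewrite /total_weight mulr_suml; apply: eq_bigr => g _.
  by rewrite -mulr_sumr cell_mass_sum.
congr (_ * _); case: a => [[g j]|]; last by rewrite big_pred0.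
by rewrite (big_pred1 (g, j)) // => x; rewrite /= eq_sym.
Qed.

Lemma init_prob (z : state) :
  \prod_(x : 'I_n * 'I_m.+2) pp_poisson_p (w x.1 * cell_mass 0 x.2)
     ((z x.1 == x.2) && (x.2 != ord0))
    = expR (- W) * state_weight 0 z.
Proof.
rewrite poisson_prod.
have -> : \sum_(x : 'I_n * 'I_m.+2) w x.1 * cell_mass 0 x.2 = W.
  rewrite -(pair_bigA _ (fun g (j : 'I_m.+2) => w g * cell_mass 0 j)) /=.
  apply: eq_bigr => g _; rewrite -mulr_sumr.
  by under eq_bigr do rewrite cell_mass0; rewrite rho_sum // mulr1.
congr (_ * _); rewrite big_mkcond.
rewrite -(pair_bigA _ (fun g (j : 'I_m.+2) =>
   if (z g == j) && (j != ord0) then w g * cell_mass 0 j else 1)) /=.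
apply: eq_bigr => g _; rewrite (bigD1 (z g)) //= eqxx big1 ?mulr1 => [|j ne].
  by rewrite cell_mass0; case: eqP.
by rewrite eq_sym (negPf ne).
Qed.

Definition letter_at (s : seq letter) (i : nat) : letter := nth None s (size s - i).

Definition word_event (s : seq letter) : set Om :=
  \bigcap_(x in [set: 'I_m * ('I_n * 'I_m.+2)])
    count_event N (cell x.2.1 x.1.+1 x.2.2) (letter_at s x.1.+1 == Some x.2).

(** Death slot [ord0] codes vacancy, so the cell it would designate is required to be empty. *)
Definition init_event (z : state) : set Om :=
  \bigcap_(x in [set: 'I_n * 'I_m.+2])
    count_event N (cell x.1 0 x.2) ((z x.1 == x.2) && (x.2 != ord0)).

Definition atom_event (z : state) (s : seq letter) : set Om := init_event z `&` word_event s.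

Lemma word_probE s : word_prob s = \prod_(i < size s) letter_prob i.+1 (letter_at s i.+1).
Proof.
elim: s => [|x s IH]; first by rewrite big_ord0.
rewrite big_ord_recr /= mulrC {2}/letter_at /= subnn /= IH; congr (_ * _).
apply: eq_bigr => i _; rewrite /letter_at /=; congr (letter_prob _ _).
by have -> : ((size s).+1 - i.+1 = (size s - i.+1).+1)%N by have := ltn_ord i; lia.
Qed.

Lemma word_event_prob (s : m.-tuple letter) :
  measurable (word_event s) /\ Pr P (word_event s) = word_prob s.
Proof.
have [x|x|x y xy|mE ->] := ppp_finite NP
  (A := fun x : 'I_m * ('I_n * 'I_m.+2) => cell x.2.1 x.1.+1 x.2.2)
  (fun x => letter_at s x.1.+1 == Some x.2 : nat)
  (l := fun x => w x.2.1 * cell_mass x.1.+1 x.2.2).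
- by apply: cell_pmeasurable; rewrite -ltnS ltn_ord.
- by apply: cell_intensity; rewrite ?ltn_ord // -ltnS ltn_ord.
- apply: cell_disjoint; apply: contra xy; case: x y => [i x] [i' x'] /=.
  by rewrite !xpair_eqE eqSS.
- split => //; rewrite -(pair_bigA _ (fun (i : 'I_m) (x : 'I_n * 'I_m.+2) =>
    pp_poisson_p (w x.1 * cell_mass i.+1 x.2) (letter_at s i.+1 == Some x))) /=.
  rewrite word_probE size_tuple; apply: eq_bigr => i _.
  exact: slot_prob.
Qed.

Lemma atom_event_prob (z : state) (s : m.-tuple letter) :
  measurable (atom_event z s) /\
  Pr P (atom_event z s) = expR (- W) * state_weight 0 z * word_prob s.
Proof.
(* Slot 0 and the later slots are specified together, so that a single application of the Poisson
   property yields the product. *)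
pose spec (x : 'I_m.+1 * ('I_n * 'I_m.+2)) : bool :=
  if (x.1 == 0 :> nat) then (z x.2.1 == x.2.2) && (x.2.2 != ord0)
  else letter_at s x.1 == Some x.2.
have [x|x|x y xy|] := ppp_finite NP
  (A := fun x : 'I_m.+1 * ('I_n * 'I_m.+2) => cell x.2.1 x.1 x.2.2)
  (fun x => spec x : nat) (l := fun x => w x.2.1 * cell_mass x.1 x.2.2).
- by apply: cell_pmeasurable; rewrite -ltnS ltn_ord.
- by apply: cell_intensity; rewrite -ltnS ltn_ord.
- by apply: cell_disjoint; apply: contra xy; case: x y => [i x] [i' x'] /=.
set E := bigcap _ _; have -> : E = atom_event z s.
  apply/seteqP; split => om.
    move=> H; split => x _; first exact: (H (ord0, x)).
    by case: x => [i x]; exact: (H (lift ord0 i, x)).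
  move=> [Hi Hw] [i x] _; rewrite /spec /=.
  by case: (unliftP ord0 i) => [i'|] ->; [exact: (Hw (i', x))|exact: Hi].
move=> mE ->; split => //.
rewrite -(pair_bigA _ (fun (i : 'I_m.+1) (x : 'I_n * 'I_m.+2) =>
    pp_poisson_p (w x.1 * cell_mass i x.2) (spec (i, x)))) /=.
rewrite big_ord_recl /= init_prob; congr (_ * _).
by rewrite word_probE size_tuple; apply: eq_bigr => i _; rewrite -slot_prob.
Qed.

Lemma word_event_inj (s s' : m.-tuple letter) om :
  word_event s om -> word_event s' om -> s = s'.
Proof.
move=> ws ws'; apply/val_inj/(@eq_from_nth _ None); rewrite !size_tuple // => k km.
have im : (m - k.+1 < m)%N by lia.
have ek : (m - (m - k.+1).+1 = k)%N by lia.
have key x : (nth None s k == Some x) = (nth None s' k == Some x).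
  have := ws (Ordinal im, x) I; have := ws' (Ordinal im, x) I.
  rewrite /count_event /letter_at /= !size_tuple ek => -> [] /eqP.
  by rewrite eqr_nat => /eqP; case: eqP; case: eqP.
case e : (nth None s k) => [x|]; first by have := key x; rewrite e eqxx => /esym/eqP.
by case e' : (nth None s' k) => [x|] //; have := key x; rewrite e e' eqxx.
Qed.

Lemma init_event_inj z z' om : init_event z om -> init_event z' om -> z = z'.
Proof.
move=> iz iz'; apply/ffunP => g.
have key j : j != ord0 -> (z g == j) = (z' g == j).
  move=> j0; have := iz (g, j) I; have := iz' (g, j) I.
  rewrite /count_event /= j0 !andbT => -> [] /eqP.
  by rewrite eqr_nat => /eqP; case: eqP; case: eqP.
have [zg|zg] := eqVneq (z g) ord0.
  by have [->//|zg'] := eqVneq (z' g) ord0; have := key _ zg'; rewrite eqxx => /eqP.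
by have := key _ zg; rewrite eqxx => /esym/eqP.
Qed.

End Atoms.

(** * Finite volume *)

Section HardCore.
Context {R : realType} {d : nat}.
Variables (n : nat) (c : 'I_n -> pp_cyc d) (w : 'I_n -> R).

Definition compatible (S : {set 'I_n}) : bool :=
  [forall g, (g \in S) ==> [forall g', (g' \in S) && (g' != g) ==> ~~ inc c g g']].

Definition set_weight (S : {set 'I_n}) : R := \prod_(g in S) w g.

Definition partition_function : R := \sum_(S | compatible S) set_weight S.

Lemma admissibleE m (z : state n m) : admissible c z = compatible (occupied z).
Proof.
rewrite /admissible /compatible; apply: eq_forallb => g; rewrite inE; congr (_ ==> _).
by apply: eq_forallb => g'; rewrite inE.
Qed.

Hypothesis w0 : forall g, 0 <= w g.

Lemma set_weight_ge0 S : 0 <= set_weight S.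
Proof. by apply: prodr_ge0. Qed.

Lemma partition_function_gt0 : 0 < partition_function.
Proof.
rewrite /partition_function (bigD1 finset.set0) /=; last first.
  by apply/forallP => g; rewrite inE.
rewrite /set_weight big_set0; apply: ltr_pwDl => //.
by apply: sumr_ge0 => S _; exact: set_weight_ge0.
Qed.

(** Each occupied cycle contributes a full sum of [rho], equal to 1: forgetting the death slots
    turns the initial law into the Gibbs weight. *)
Lemma state_weight_sum m (t0 h : R) (S : {set 'I_n}) : 0 <= h ->
  \sum_(z : state n m | occupied z == S) state_weight w t0 h 0 z = set_weight S.
Proof.
move=> h0; pose f (g : 'I_n) (j : 'I_m.+2) := if j == ord0 then 1 else w g * rho m t0 h 0 j.
pose Q (g : 'I_n) := [pred j : 'I_m.+2 | (j != ord0) == (g \in S)].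
rewrite (eq_bigl (fun z => z \in family Q)); last first.
  move=> z; apply/eqP/familyP => [e g|H]; first by rewrite inE -e inE.
  by apply/setP => g; rewrite inE; have := H g; rewrite inE => /eqP.
rewrite -(bigA_distr_big_dep _ f) /set_weight [RHS]big_mkcond; apply: eq_bigr => g _.
case: ifPn => gS.
  transitivity (\sum_(j < m.+2) w g * rho m t0 h 0 j); last by rewrite -mulr_sumr (rho_sum _ h0) // mulr1.
  rewrite [RHS](bigD1 ord0) //= {1}/rho ltnn mulr0 add0r.
  apply: eq_big => [j|j]; first by rewrite /Q /= gS; case: (j != ord0).
  by rewrite /Q /= gS /f => /eqP/negPf ->.
by rewrite (big_pred1 ord0) // => j; rewrite /Q /= (negPf gS); case: (j == ord0).
Qed.

Lemma state_weight_total m (t0 h : R) : 0 <= h ->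
  \sum_(z : state n m | admissible c z) state_weight w t0 h 0 z = partition_function.
Proof.
move=> h0; rewrite (partition_big (@occupied n m) compatible) => [|z]; last by rewrite admissibleE.
apply: eq_bigr => S cS; rewrite -(state_weight_sum m t0 S h0); apply: eq_bigl => z.
by rewrite admissibleE; case: eqP => [->|]; rewrite ?cS ?andbF.
Qed.

End HardCore.

(** * The chain on a fixed realization *)

Section Realization.
Context {R : realType} {d : nat} {dd : measure_display} {Om : measurableType dd}.
Variable N : Om -> set (pp_gpoint R d).
Variables (n m : nat) (c : 'I_n -> pp_cyc d) (t0 h : R) (L : set (pp_site d)).
Hypothesis c_inj : injective c.
Hypothesis c_range : forall g, pp_supp g `<=` L <-> exists i, g = c i.
Hypothesis h0 : 0 <= h.

Local Notation tau := (grid_time t0 h).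
Local Notation cell := (cell m c tau).
Local Notation state := (state n m).
Local Notation letter := (letter n m).
Local Notation run := (run (m := m) c).
Local Notation word_event := (word_event N c t0 h).
Local Notation init_event := (init_event N c t0 h).
Local Notation atom_event := (atom_event N c t0 h).
Local Notation empty_state := ([ffun=> ord0] : state).

(** All pairs of cycles are taken, incompatible or not, and the clash is phrased through non-empty
    boxes so that its probability comes from counts. *)
Definition clash_event : set Om :=
  \bigcup_(x in [set x : 'I_m * ('I_n * 'I_n) | true])
    (~` count_event N (box (c x.2.1) (bset t0 h x.1.+1) setT) 0 `&`
     ~` count_event N (box (c x.2.2) `]-oo, tau x.1] (dset m t0 h x.1.+1)) 0).

Variable om : Om.
Local Notation M := (pp_restrict (N om) L).
Hypothesis clans_finite : forall p, 0 < pp_plife p -> finite_set (pp_clan (N om) p).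
Hypothesis none_at_end : forall p, N om p -> pp_ptime p <> tau m.
Hypothesis clans_late : forall g p, pp_clan M (c g, tau m, 1) p -> tau 0 < pp_ptime p.
Hypothesis no_clash : ~ clash_event om.

Lemma inside g p : N om p -> pp_pcyc p = c g -> M p.
Proof. by move=> Np pg; split => //; rewrite pg; apply/c_range; exists g. Qed.

Lemma word_matches (s : m.-tuple letter) : word_event s om ->
  matches c tau M s.
Proof.
move=> ws i; rewrite size_tuple => /andP[i0 im] g j.
have im' : (i.-1 < m)%N by lia.
have := ws (Ordinal im', (g, j)) I; rewrite /= /letter_at size_tuple prednK // => ce.
split=> [e|p [Np pL] pc].
  move: ce; rewrite e eqxx => /count1P[p pE]; exists p.
  have : (N om `&` cell g i j) p by rewrite pE.
  by move=> [Np pc]; split => //; have [pg _ _ _] := pc; exact: inside pg.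
move: ce; case: eqP => [e /count1P[q qE]|_ /count0P e].
  split => // r [Nr _] rc.
  have : (N om `&` cell g i j) r by []; have : (N om `&` cell g i j) p by [].
  by rewrite qE => -> ->.
by have : (N om `&` cell g i j) p by []; rewrite e.
Qed.

(** Coupling from the past over the window of the grid: every initial state made of existing points
    leads to the same configuration. *)
Lemma word_eta (z : state) (s : m.-tuple letter) :
  (forall g, z g != ord0 -> exists q, M q /\ cell g 0 (z g) q) ->
  word_event s om ->
  forall g, pp_eta (tau m) M g = (\1_(c @` [set` occupied (run z s)]) g)%:E.
Proof.
move=> zM ws; have mt := word_matches ws.
(* These are the points alive at the end and their ancestors; [clans_late] places their births after
   [tau 0]. *)
pose F := \bigcup_(g in [set: 'I_n]) pp_clan M (c g, tau m, 1).
have Mcyc p : M p -> exists g, pp_pcyc p = c g by move=> [_ /c_range].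
have cN p : pp_clan M p `<=` pp_clan (N om) p by apply: clan_sub => q [].
have FM : F `<=` M by move=> p [g _ /clan_mem].
have Fcl p : F p -> pp_A1 M p `<=` F.
  by move=> [g _ gp] q pq; exists g => //; exact: clan_A1 pq.
have Flife p : F p -> 0 < pp_plife p by move=> [g _ /clan_life].
have Flate p : F p -> tau 0 < pp_ptime p by move=> [g _ /clans_late].
have Ffin p : F p -> finite_set (pp_clan M p).
  by move=> /Flife lp; apply: sub_finite_set (clans_finite lp); exact: cN.
have thomo : {homo tau : i j / (i <= j)%N >-> i <= j} by exact: grid_time_homo.
have nc i p q : (0 < i <= m)%N -> M p -> M q ->
  0 < pp_plife p -> birth_slot tau i (pp_ptime p) ->
  0 < pp_plife q -> pp_ptime q <= tau i.-1 -> tau i.-1 < pdeath q <= tau i -> False.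
  move=> /andP[i0 im] Mp Mq lp bp lq tq dq; apply: no_clash.
  have im' : (i.-1 < m)%N by lia.
  have [g pg] := Mcyc p Mp; have [g' qg'] := Mcyc q Mq.
  exists (Ordinal im', (g, g')) => //=; split => /count0P e.
    have : (N om `&` box (c g) (bset t0 h i.-1.+1) setT) p.
      by split; [case: Mp|split => //; rewrite prednK].
    by rewrite e.
  have : (N om `&` box (c g') `]-oo, tau i.-1] (dset m t0 h i.-1.+1)) q.
    split; first by case: Mq.
    split => //.
    case/andP : dq => d1 d2.
    by rewrite /dset /death_slot /= d1 prednK // im.
  by rewrite e.
have tr := tracks_run thomo Mcyc FM Fcl Flife Ffin nc (eq_leq (size_tuple s)) mt
  (tracks_init Flate zM).
rewrite size_tuple in tr.
apply: (tracks_eta thomo Mcyc FM Flife Flate Ffin (size_tuple s) mt tr).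
move=> p Mp /andP[tp pt]; have [g pg] := Mcyc p Mp; exists g => //.
apply: clan_alive => //; first by rewrite pg; exact: incompat_refl.
by rewrite /pdeath in pt; rewrite pt andbT lt_neqAle tp andbT; apply/eqP/none_at_end; case: Mp.
Qed.

Lemma init_points (z : state) : init_event z om ->
  forall g, z g != ord0 -> exists q, M q /\ cell g 0 (z g) q.
Proof.
move=> iz g zg; have := iz (g, z g) I; rewrite /= eqxx zg => /count1P[p pE].
have [Np pc] : (N om `&` cell g 0 (z g)) p by rewrite pE.
by exists p; split => //; have [pg _ _ _] := pc; exact: inside pg.
Qed.

Lemma occupied_inj (S S' : {set 'I_n}) :
  (forall g, (\1_(c @` [set` S]) g)%:E = (\1_(c @` [set` S']) g)%:E :> \bar R) -> S = S'.
Proof.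
have sub (A B : {set 'I_n}) : (forall g, (\1_(c @` [set` A]) g)%:E = (\1_(c @` [set` B]) g)%:E :> \bar R) ->
    forall g, g \in A -> g \in B.
  move=> h1 g gA; have [] := h1 (c g); rewrite !indicE mem_set; last by exists g.
  case: (boolP (c g \in _)) => [|_ /eqP]; last by rewrite oner_eq0.
  by move=> /set_mem[g' /= g'B /c_inj <-].
move=> e; apply/setP => g; apply/idP/idP; exact: sub.
Qed.

Lemma word_atom_agree (z : state) (s : seq letter) : atom_event z s om -> size s = m ->
  occupied (run z s) = occupied (run empty_state s).
Proof.
move=> [iz ws] /eqP sm; apply: occupied_inj => g.
rewrite -(word_eta (s := Tuple sm) (init_points iz)) //.
by rewrite -(word_eta (z := empty_state) (s := Tuple sm)) // => g'; rewrite ffunE.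
Qed.

End Realization.

Section GridBound.
Context {R : realType} {d : nat} {dd : measure_display} {Om : measurableType dd}.
Variables (alpha : R) (V : pp_site d -> \bar R) (P : probability Om R).
Variable N : Om -> set (pp_gpoint R d).
Hypothesis alpha0 : 0 < alpha.
Hypothesis V0 : forall z, (0 <= V z)%E.
Hypothesis NP : pp_is_PPP alpha V P N.
Variables (n m : nat) (c : 'I_n -> pp_cyc d) (t0 h : R).
Hypothesis c_inj : injective c.
Hypothesis h0 : 0 <= h.

Local Notation w := (fun g => weight alpha V (c g)).
Local Notation tau := (grid_time t0 h).
Local Notation cell := (cell m c tau).
Local Notation state := (state n m).
Local Notation letter := (letter n m).
Local Notation run := (run (m := m) c).
Local Notation W := (total_weight w).
Local Notation word_event := (word_event N c t0 h).
Local Notation atom_event := (atom_event N c t0 h).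
Local Notation empty_state := ([ffun=> ord0] : state).

Let w0 g : 0 <= w g. Proof. exact: weight_ge0. Qed.

Local Notation clash_event := (clash_event N m c t0 h).

(** There are [m n ^ 2] choices of a slot and two cycles; in each, the birth count and the death
    count are independent with masses at most [h], the weights being at most 1. *)
Lemma clash_event_bound : measurable clash_event /\
  Pr P clash_event <= m%:R * (n%:R ^+ 2 * h ^+ 2).
Proof.
have C (x : 'I_m * ('I_n * 'I_n)) : let E :=
    (~` count_event N (box (c x.2.1) (bset t0 h x.1.+1) setT) 0 `&`
     ~` count_event N (box (c x.2.2) `]-oo, tau x.1] (dset m t0 h x.1.+1)) 0) in
   measurable E /\ Pr P E <= h ^+ 2.
  case: x => [k [g g']] /=.
  have [|||||||mE PE] := ppp_clash NP
    (A := box (c g) (bset t0 h k.+1) setT) (B := box (c g') `]-oo, tau k] (dset m t0 h k.+1))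
    (a := w g * h) (b := w g' * (1 - expR (- h))).
  - by exact: (box_pmeasurable (c g) (bset_measurable t0 h k.+1) measurableT).
  - by exact: (intensity_box alpha0 V0 (c g) (mass_birth t0 h0 k)).
  - exact: mulr_ge0.
  - apply: (box_pmeasurable (c g')); first exact: measurable_itv.
    by apply: dset_measurable; have := ltn_ord k; lia.
  - by exact: (intensity_box alpha0 V0 (c g') (mass_death t0 h0 (ltn_ord k))).
  - by apply: mulr_ge0 => //; exact: one_sub_expRN.
  - apply/seteqP; split => // p [[_ _ /andP[/= b1 _] _] [_ _ b2 _]].
    by move: b2; rewrite /= in_itv /= leNgt b1.
  split => //; apply: le_trans PE _; rewrite expr2; apply: ler_pM.
  - exact: mulr_ge0.
  - by apply: mulr_ge0 => //; exact: one_sub_expRN.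
  - by rewrite ler_piMl // weight_le1.
  - apply: le_trans (ler_piMl _ _) _; first exact: one_sub_expRN.
      exact: weight_le1.
    by have := @expR_ge1Dx R (- h); lra.
split; first by apply: measurable_finU => x; have [] := C x.
apply: le_trans (Pr_finU_le _ _ _) _; first by move=> x; have [] := C x.
apply: le_trans (_ : \sum_(x : 'I_m * ('I_n * 'I_n)) h ^+ 2 <= _).
  by apply: ler_sum => x _; have [] := C x.
rewrite sumr_const !card_prod !card_ord -[leLHS]mulr_natl !natrM.
by rewrite le_eqVlt; apply/orP; left; apply/eqP; ring.
Qed.

Definition outcome_event (S : {set 'I_n}) : set Om :=
  \bigcup_(s in [set s : m.-tuple letter | occupied (run empty_state s) == S]) word_event s.

Definition disagree_event : set Om :=
  \bigcup_(x in [set x : state * m.-tuple letter | admissible c x.1 &&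
     (occupied (run x.1 x.2) != occupied (run empty_state x.2))]) atom_event x.1 x.2.

Lemma measurable_outcome S : measurable (outcome_event S).
Proof.
apply: measurable_finU => s.
by have [] := word_event_prob alpha0 V0 NP t0 c_inj h0 s.
Qed.

Lemma measurable_disagree : measurable disagree_event.
Proof.
apply: measurable_finU => x.
by have [] := atom_event_prob alpha0 V0 NP t0 c_inj h0 x.1 x.2.
Qed.

(* [outcome_event] only involves births after [tau 0], hence is independent of the
   initial state; this is the product on the right-hand side. *)
Lemma outcome_lower_bound S : compatible c S ->
  m%:R * (balance_rate w * h ^+ 2) <= 1 ->
  (1 - m%:R * (balance_rate w * h ^+ 2)) * (expR (- W) * set_weight w S) <=
  Pr P (outcome_event S) * (expR (- W) * partition_function c w) + Pr P disagree_event.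
Proof.
move=> cS hm.
pose wp (s : m.-tuple letter) := word_prob w t0 h s.
pose sw (z : state) := state_weight w t0 h 0 z.
have wp0 s : 0 <= wp s.
  by have [_ e] := word_event_prob alpha0 V0 NP t0 c_inj h0 s; rewrite /wp -e Pr_ge0.
have sw0 z : 0 <= sw z by exact: state_weight_ge0.
have F0 z s : 0 <= expR (- W) * sw z * wp s.
  by apply: mulr_ge0; [apply: mulr_ge0; [exact: expR_ge0|exact: sw0]|exact: wp0].
have -> : Pr P (outcome_event S) = \sum_(s : m.-tuple letter | occupied (run empty_state s) == S) wp s.
  rewrite Pr_finU.
  - by apply: eq_bigr => s _; have [_ ->] := word_event_prob alpha0 V0 NP t0 c_inj h0 s.
  - by move=> s; have [] := word_event_prob alpha0 V0 NP t0 c_inj h0 s.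
  - move=> s s' ne; apply/seteqP; split => // om [h1 h2].
    by move/eqP : ne; apply; exact: word_event_inj h1 h2.
have -> : Pr P disagree_event = \sum_(x : state * m.-tuple letter | admissible c x.1 &&
     (occupied (run x.1 x.2) != occupied (run empty_state x.2))) expR (- W) * sw x.1 * wp x.2.
  rewrite Pr_finU.
  - by apply: eq_bigr => x _; have [_ ->] := atom_event_prob alpha0 V0 NP t0 c_inj h0 x.1 x.2.
  - by move=> x; have [] := atom_event_prob alpha0 V0 NP t0 c_inj h0 x.1 x.2.
  - move=> [z s] [z' s'] ne; apply/seteqP; split => // om [[i1 w1] [i2 w2]].
    move/eqP : ne; apply; congr (_, _); first exact: init_event_inj i1 i2.
    exact: word_event_inj w1 w2.
(* After the last slot only death slot [m.+1] is left, and [rho_last] gives it probability 1: a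
   single state carries the whole weight of [S]. *)
pose zS : state := [ffun g => if g \in S then ord_max else ord0].
have oS : occupied zS = S by apply/setP => g; rewrite inE ffunE; case: ifP.
have azS : admissible c zS by rewrite admissibleE oS.
have swS : state_weight w t0 h m zS = set_weight w S.
  rewrite /state_weight /set_weight [RHS]big_mkcond; apply: eq_bigr => g _.
  by rewrite ffunE; case: (g \in S); rewrite ?eqxx //= rho_last mulr1.
have := path_weight_lb t0 h0 w0 (leqnn m) hm azS; rewrite swS => lb.
rewrite mulrCA; apply: le_trans (ler_wpM2l (expR_ge0 _) lb) _.
rewrite path_weightE mulr_sumr.
apply: le_trans (_ : \sum_(x : state * m.-tuple letter | admissible c x.1 &&
   (occupied (run x.1 x.2) == S)) expR (- W) * sw x.1 * wp x.2 <= _).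
  rewrite [leRHS]big_mkcond.
  rewrite -(pair_bigA _ (fun z (s : m.-tuple letter) => if admissible c z &&
    (occupied (run z s) == S) then expR (- W) * sw z * wp s else 0)) /=.
  apply: ler_sum => z _; rewrite mulr_sumr; apply: ler_sum => s _.
  have [e|_] := eqVneq (run z s) zS; last first.
    by rewrite !mul0r mulr0; case: ifP => // _; exact: F0.
  rewrite e oS eqxx andbT mul1r; case: (admissible c z).
    by rewrite mul1r le_eqVlt; apply/orP; left; apply/eqP; rewrite -/(wp s) -/(sw z); ring.
  by rewrite mul0r !mulr0.
(* Either the empty start ends in [S] too, and dropping the constraint on the other start leaves a
   product, or the two starts disagree. *)
rewrite [leLHS](bigID (fun x : state * m.-tuple letter => occupied (run empty_state x.2) == S)) /=; apply: lerD.
  rewrite -(state_weight_total c w m t0 h0) mulr_sumr mulr_suml.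
  apply: le_trans (_ : \sum_(x : state * m.-tuple letter | admissible c x.1 &&
     (occupied (run empty_state x.2) == S)) expR (- W) * sw x.1 * wp x.2 <= _).
    rewrite big_mkcond [leRHS]big_mkcond; apply: ler_sum => x _.
    have := F0 x.1 x.2.
    by case: (admissible c x.1); case: (_ == S); case: (_ == S).
  rewrite -(pair_big (fun z : state => admissible c z)
    (fun s : m.-tuple letter => occupied (run empty_state s) == S)
    (fun z s => expR (- W) * sw z * wp s)) /=.
  rewrite exchange_big /= le_eqVlt; apply/orP; left; apply/eqP; apply: eq_bigr => s _.
  by rewrite mulr_sumr; apply: eq_bigr => z _; rewrite mulrC.
rewrite big_mkcond [leRHS]big_mkcond; apply: ler_sum => x _.
have := F0 x.1 x.2.
case: (admissible c x.1) => //=; case: eqP => //= [e|_]; last by case: ifP.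
by rewrite e eq_sym; case: ifP.
Qed.

End GridBound.

(** * Null sets and upper limits of events *)

Section AlmostSure.
Context {R : realType} {dd : measure_display} {Om : measurableType dd}.
Variable P : probability Om R.

Lemma ae_notin (A : set Om) : measurable A -> Pr P A = 0 -> {ae P, forall om, ~ A om}.
Proof.
by move=> mA A0; exists A; split => //; [rewrite PrE // A0|move=> om /= /contrapT].
Qed.

Lemma ae_measurable (Q : Om -> Prop) : {ae P, forall om, Q om} ->
  exists B, [/\ measurable B, Pr P B = 0 & forall om, ~ B om -> Q om].
Proof.
move=> [B [mB B0 QB]]; exists B; split => //; first by rewrite /Pr B0.
by move=> om nB; apply: contrapT => nQ; apply: nB; exact: QB.
Qed.

Lemma Pr_setD_null A B : measurable A -> measurable B -> Pr P B = 0 ->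
  Pr P (A `\` B) = Pr P A.
Proof.
move=> mA mB B0; apply/eqP; rewrite eq_le; apply/andP; split.
  exact: (Pr_le P (measurableD mA mB) mA (@subDsetl _ A B)).
rewrite -[leRHS]addr0 -B0; apply: le_trans (PrU_le P (measurableD mA mB) mB).
apply: (Pr_le P mA (measurableU _ _ (measurableD mA mB) mB)).
by move=> x Ax; have [|] := pselect (B x); [right|left].
Qed.

Lemma measurable_lim_sup (F : (set Om)^nat) : (forall n, measurable (F n)) ->
  measurable (lim_sup_set F).
Proof.
by move=> mF; apply: bigcap_measurable => // k _; apply: bigcup_measurable => j _.
Qed.

(** Continuity from above along the tail unions; no rate results. *)
Lemma lim_sup0_Pr (F : (set Om)^nat) : (forall n, measurable (F n)) ->
  Pr P (lim_sup_set F) = 0 ->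
  forall e, 0 < e -> exists n0, forall n, (n0 <= n)%N -> Pr P (F n) <= e.
Proof.
move=> mF F0 e e0; have mU n : measurable (\bigcup_(k in [set k | (n <= k)%N]) F k).
  by apply: bigcup_measurable => k _.
have cv : P (\bigcup_(k in [set k | (n <= k)%N]) F k) @[n --> \oo] --> P (lim_sup_set F).
  by apply: lim_sup_set_cvg => //; apply: le_lt_trans (probability_le1 P (mU 0%N)) (ltry _).
rewrite (PrE P (measurable_lim_sup mF)) F0 in cv.
have cvr : Pr P (\bigcup_(k in [set k | (n <= k)%N]) F k) @[n --> \oo] --> (0 : R).
  exact: (fine_cvg cv).
have [n0 _ n0P] := cvgr_lt _ cvr e e0.
exists n0 => n n0n; apply: le_trans (ltW (n0P n n0n)).
by apply: Pr_le => // x Fx; exists n => /=.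
Qed.

Lemma borel_cantelli_geometric (F : (set Om)^nat) : (forall n, measurable (F n)) ->
  (forall n, Pr P (F n) <= 1 / (2 ^ n.+1)%:R) -> Pr P (lim_sup_set F) = 0.
Proof.
move=> mF hF; rewrite /Pr lim_sup_set_cvg0 //.
apply: le_lt_trans (ltry 1); apply: le_trans (epsilon_trick0 xpredT (@ler01 R)).
have le n : (P (F n) <= (1 / (2 ^ n.+1)%:R)%:E)%E by rewrite PrE // lee_fin.
by apply: lee_nneseries => // n _; exact: le.
Qed.

End AlmostSure.

Lemma finite_set_lower_bound (R : realType) (A : set R) (t : R) : finite_set A ->
  exists k0 : nat, forall k : nat, (k0 <= k)%N -> forall x, A x -> t - k%:R < x.
Proof.
move=> /finite_seqP[s ->]; elim: s => [|x s [k0 IH]]; first by exists 0%N => k _ x.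
have [k1 k1P] : exists k1 : nat, t - x < k1%:R by exists (Num.trunc `|t - x|).+1;
  rewrite (le_lt_trans (ler_norm _)) // truncnS_gt.
exists (maxn k0 k1) => k; rewrite geq_max => /andP[kk0 kk1] y /=.
rewrite inE => /predU1P[->|ys]; last exact: IH.
have : k1%:R <= k%:R :> R by rewrite ler_nat.
by lra.
Qed.

Section Mesh.
Context {R : realType}.
Variable B : nat.

(* The horizon is [k]; the number of slots makes the accumulated error
   [steps k * mesh k ^ 2] summable. *)
Definition steps (k : nat) : nat := (B * k ^ 2 * 2 ^ k.+1).+1.
Definition mesh (k : nat) : R := k%:R / (steps k)%:R.

Lemma mesh_ge0 k : 0 <= mesh k.
Proof. by rewrite divr_ge0 // ler0n. Qed.

Lemma tau_end (t : R) k : grid_time (t - k%:R) (mesh k) (steps k) = t.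
Proof. by rewrite /grid_time /mesh mulrCA divff ?mulr1 ?subrK // pnatr_eq0. Qed.

Lemma tau_start (t : R) k : grid_time (t - k%:R) (mesh k) 0 = t - k%:R.
Proof. by rewrite /grid_time mul0r addr0. Qed.

(** [steps * mesh ^ 2] is [k ^ 2 / steps], and [steps] exceeds [B k ^ 2 2 ^ (k + 1)]. *)
Lemma mesh_small (a : R) k : 0 <= a <= B%:R ->
  (steps k)%:R * (a * mesh k ^+ 2) <= 1 / (2 ^ k.+1)%:R.
Proof.
move=> /andP[a0 aB]; have s0 : 0 < (steps k)%:R :> R by rewrite ltr0n.
have -> : (steps k)%:R * (a * mesh k ^+ 2) = a * k%:R ^+ 2 / (steps k)%:R.
  by rewrite /mesh; field; rewrite gt_eqF.
rewrite ler_pdivrMr // mulrAC ler_pdivlMr ?ltr0n ?expn_gt0 // mul1r.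
apply: le_trans (_ : (B * k ^ 2 * 2 ^ k.+1)%:R <= _); last by rewrite ler_nat leqnSn.
by rewrite !natrM !natrX ler_wpM2r // ler_wpM2r.
Qed.

End Mesh.

Section NoBirth.
Context {R : realType} {d : nat} {dd : measure_display} {Om : measurableType dd}.
Variables (alpha : R) (V : pp_site d -> \bar R) (P : probability Om R).
Variable N : Om -> set (pp_gpoint R d).
Hypothesis NP : pp_is_PPP alpha V P N.

Lemma ae_no_birth_at (t : R) : {ae P, forall om p, N om p -> pp_ptime p <> t}.
Proof.
pose A : set (pp_gpoint R d) := [set p | pp_ptime p = t].
have mA : pp_pmeasurable A.
  move=> g; rewrite [X in measurable X](_ : _ = fst @^-1` [set t]) //.
  rewrite -[X in measurable X]setTI; apply: measurable_fst => //.
have lA : pp_intensity alpha V A = 0%:E.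
  rewrite /pp_intensity esum1 // => g _.
  rewrite [X in (_ * X)%E](_ : _ = 0%E) ?mule0 //.
  rewrite -[RHS](integral_set1 (fun t' => \int[@lebesgue_measure R]_(s in
    [set s : R | (0 < s)%R /\ A ((g, t' : R), s)]) (expR (- s))%:E)%E t).
  rewrite [RHS]integral_mkcond; apply: eq_integral => t' _; rewrite patchE.
  case: ifPn => // /negP nt; rewrite [X in integral _ X](_ : _ = set0) ?integral_set0 //.
  by apply/seteqP; split => // s [_ e]; apply: nt; exact: mem_set.
have [mE PE] := ppp_single NP 0 mA lA.
have := ae_notin (A := ~` count_event N A 0) (P := P); rewrite Pr_setC // PE.
rewrite /pp_poisson_p expr0 fact0 oppr0 expR0 divr1 mulr1 subrr => /(_ (measurableC mE) erefl).
apply: filterS => om /contrapT/count0P NA p Np pt.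
by have : (N om `&` A) p by []; rewrite NA.
Qed.

End NoBirth.

Section FiniteVolume.
Context {R : realType} {d : nat} {dd : measure_display} {Om : measurableType dd}.
Variables (alpha : R) (V : pp_site d -> \bar R) (P : probability Om R).
Variable N : Om -> set (pp_gpoint R d).
Hypothesis alpha0 : 0 < alpha.
Hypothesis V0 : forall z, (0 <= V z)%E.
Hypothesis NP : pp_is_PPP alpha V P N.
Hypothesis clans : {ae P, forall om, forall p : pp_gpoint R d,
  0 < pp_plife p -> finite_set (pp_clan (N om) p)}.
Variables (n : nat) (c : 'I_n -> pp_cyc d) (t : R) (L : set (pp_site d)).
Hypothesis c_inj : injective c.
Hypothesis c_range : forall g, pp_supp g `<=` L <-> exists i, g = c i.

Local Notation w := (fun g => weight alpha V (c g)).
Local Notation W := (total_weight w).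
Local Notation Z := (partition_function c w).

Let w0 g : 0 <= w g. Proof. exact: weight_ge0. Qed.

(** The mesh must absorb both the stationarity error, of constant [balance_rate], and the clash
    bound, of constant [n ^ 2]. *)
Definition mesh_bound : nat := ((Num.trunc (balance_rate w)).+1 + n ^ 2)%N.
Local Notation steps := (steps mesh_bound).
Local Notation mesh := (mesh mesh_bound).
Local Notation start k := (t - k%:R).

Definition outcomes (S : {set 'I_n}) (k : nat) : set Om :=
  outcome_event N (steps k) c (start k) (mesh k) S.
Definition clashes (k : nat) : set Om := clash_event N (steps k) c (start k) (mesh k).
Definition disagreements (k : nat) : set Om :=
  disagree_event N (steps k) c (start k) (mesh k).

Definition gibbs_prob (S : {set 'I_n}) : R :=
  if compatible c S then set_weight w S / Z else 0.

Lemma gibbs_prob_sum : \sum_S gibbs_prob S = 1.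
Proof.
rewrite -big_mkcond -mulr_suml divff //; apply: lt0r_neq0.
exact: partition_function_gt0.
Qed.

Lemma balance_rate_bound : 0 <= balance_rate w <= mesh_bound%:R.
Proof.
rewrite balance_rate_ge0 //=; apply: le_trans (ltW (truncnS_gt _)) _.
by rewrite ler_nat leq_addr.
Qed.

Definition good om : Prop := exists k0, forall k, (k0 <= k)%N ->
  ~ disagreements k om /\ forall S, outcomes S k om ->
  forall g, pp_eta t (pp_restrict (N om) L) g = (\1_(c @` [set` S]) g)%:E.

(** Almost surely clashes stop and nothing is born at [t]; the clans of the [n] test points are
    finite, so for large [k] all their points are born after [t - k] and the chain is exact. *)
Lemma ae_good : {ae P, forall om, good om}.
Proof.
have clash0 : {ae P, forall om, ~ lim_sup_set clashes om}.
  have mC k : measurable (clashes k).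
    by have [] := clash_event_bound alpha0 V0 NP (steps k) c (start k) (mesh_ge0 mesh_bound k).
  apply: ae_notin; first exact: measurable_lim_sup.
  apply: borel_cantelli_geometric => // k.
  have [_] := clash_event_bound alpha0 V0 NP (steps k) c (start k) (mesh_ge0 mesh_bound k).
  move/le_trans; apply; apply: mesh_small.
  by rewrite exprn_ge0 //= -natrX ler_nat leq_addl.
have birth := ae_no_birth_at NP t.
move: clans; apply: filter_app; move: birth; apply: filter_app; move: clash0; apply: filterS.
move=> om nclash nbirth fin.
have [k1 k1P] : exists k1, forall k, (k1 <= k)%N -> ~ clashes k om.
  apply: contrapT => nk; apply: nclash => k1 _; apply: contrapT => nU; apply: nk; exists k1.
  by move=> k kk1 Ck; apply: nU; exists k.
have [k2 k2P] : exists k0 : nat, forall k : nat, (k0 <= k)%N -> forall x,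
    ((@pp_ptime R d) @` \bigcup_(g in [set: 'I_n]) pp_clan (pp_restrict (N om) L) (c g, t, 1)) x ->
    t - k%:R < x.
  apply: finite_set_lower_bound; apply: finite_image; apply: bigcup_finite => [|g _].
    exact: finite_finset.
  apply: (@sub_finite_set _ _ (pp_clan (N om) (c g, t, 1))); last by apply: fin; rewrite /pp_plife.
  by apply: clan_sub => q [].
exists (maxn k1 k2) => k; rewrite geq_max => /andP[kk1 kk2].
have none p : N om p -> pp_ptime p <> grid_time (start k) (mesh k) (steps k).
  by rewrite tau_end; exact: nbirth.
have late g p : pp_clan (pp_restrict (N om) L) (c g, grid_time (start k) (mesh k) (steps k), 1) p ->
    grid_time (start k) (mesh k) 0 < pp_ptime p.
  rewrite tau_end tau_start => gp; apply: (k2P k kk2); exists p => //; by exists g.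
split.
  move=> [[z s] /= /andP[_ /eqP ne] ae]; apply: ne.
  by apply: (word_atom_agree c_inj c_range (mesh_ge0 _ _) fin none late (k1P k kk1) ae); rewrite size_tuple.
move=> S [s /= /eqP <- ws] g; rewrite -{1}(tau_end mesh_bound t k).
apply: (word_eta c_range (mesh_ge0 _ _) fin none late (k1P k kk1) _ ws).
by move=> g'; rewrite ffunE.
Qed.

(** The upper limit of the outcomes, less a null set, is a measurable substitute for the event that
    the configuration is [S]. These substitutes are disjoint and each has at least its Gibbs
    probability, so no slack is left. *)
Lemma finite_volume_law : exists E : {set 'I_n} -> set Om,
  [/\ forall S, measurable (E S), forall S, Pr P (E S) = gibbs_prob S,
      forall S S', S != S' -> E S `&` E S' = set0 &
      forall S om, E S om ->
        forall g, pp_eta t (pp_restrict (N om) L) g = (\1_(c @` [set` S]) g)%:E].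
Proof.
have [B [mB B0 goodB]] := ae_measurable ae_good.
have mO S k : measurable (outcomes S k).
  exact: (measurable_outcome alpha0 V0 NP (steps k) (start k) c_inj (mesh_ge0 mesh_bound k)).
have mD k : measurable (disagreements k).
  exact: (measurable_disagree alpha0 V0 NP (steps k) (start k) c_inj (mesh_ge0 mesh_bound k)).
(* Off the null set [B] disagreements stop, so their probabilities will tend to 0. *)
have D0 : Pr P (lim_sup_set disagreements) = 0.
  apply: le_anti; rewrite Pr_ge0 andbT -B0; apply: Pr_le => //; first exact: measurable_lim_sup.
  move=> om Dom; apply: contrapT => /goodB[k0 k0P].
  by have [k /= kk0 Dk] := Dom k0 I; case: (k0P k kk0) => + _; apply.
pose E S := lim_sup_set (outcomes S) `\` B.
have mL S : measurable (lim_sup_set (outcomes S)) by exact: measurable_lim_sup.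
have mE S : measurable (E S) by exact: measurableD.
have etaE S om : E S om ->
    forall g, pp_eta t (pp_restrict (N om) L) g = (\1_(c @` [set` S]) g)%:E.
  move=> [So /goodB[k0 k0P]]; have [k /= kk0 Sk] := So k0 I.
  by case: (k0P k kk0) => _; apply.
have disj S S' : S != S' -> E S `&` E S' = set0.
  move=> ne; apply/seteqP; split => // om [eS eS'].
  by move/eqP: ne; apply; apply: (occupied_inj c_inj (R := R)) => g; rewrite -(etaE _ _ eS) -(etaE _ _ eS').
have lb S : gibbs_prob S <= Pr P (E S).
  rewrite /gibbs_prob; case: ifPn => cS; last exact: Pr_ge0.
  rewrite /E Pr_setD_null //; apply: Pr_lim_sup => // e e0.
  have Z0 : 0 < Z by exact: partition_function_gt0.
  set a := set_weight w S / Z.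
  have a0 : 0 <= a by rewrite divr_ge0 ?(ltW Z0) ?set_weight_ge0.
  have eZ : 0 < expR (- W) * Z by rewrite mulr_gt0 ?expR_gt0.
  (* Half of [e] goes to the disagreements, scaled by the factor [exp (- W) * Z] of the lower bound,
     and half to the stationarity error. *)
  have [n1 n1P] := lim_sup0_Pr mD D0 (mulr_gt0 (divr_gt0 e0 (ltr0n R 2)) eZ).
  have [n2 n2P] : exists n2 : nat, forall k, (n2 <= k)%N -> a / (2 ^ k.+1)%:R <= e / 2.
    exists (Num.trunc (2 * a / e)) => k kk.
    rewrite ler_pdivrMr ?ltr0n ?expn_gt0 //.
    have : 2 * a / e < (2 ^ k.+1)%:R.
      apply: lt_le_trans (truncnS_gt _) _; rewrite ler_nat.
      by apply: leq_trans (ltnW (ltn_expl k.+1 (ltnSn 1))); rewrite ltnS.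
    by rewrite ltr_pdivrMr // => h1; lra.
  exists (maxn n1 n2) => k; rewrite geq_max => /andP[kk1 kk2].
  have small := mesh_small k balance_rate_bound.
  have le1 : 1 / (2 ^ k.+1)%:R <= 1 :> R.
    by rewrite ler_pdivrMr ?ltr0n ?expn_gt0 // mul1r ler1n expn_gt0.
  have := outcome_lower_bound alpha0 V0 NP (start k) c_inj (mesh_ge0 mesh_bound k) cS
     (le_trans small le1).
  set x := (steps k)%:R * _ in small *; move=> H.
  rewrite -(ler_pM2r eZ) -/(outcomes S k).
  have sE : set_weight w S = a * Z by rewrite /a divfK // gt_eqF.
  rewrite sE in H.
  have H1 := n1P k kk1; have H2 := n2P k kk2.
  have H3 : x * a <= e / 2.
    apply: le_trans H2; rewrite mulrC -[_^-1]mul1r; exact: ler_wpM2l.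
  have H4 : x * a * (expR (- W) * Z) <= e / 2 * (expR (- W) * Z).
    by rewrite ler_wpM2r // ltW.
  rewrite -/(outcomes S k) -/(disagreements k) in H.
  move: H H1 H4; set q := expR (- W) * Z => H H1 H4.
  have e1 : (1 - x) * (expR (- W) * (a * Z)) = a * q - x * a * q by rewrite /q; ring.
  by rewrite e1 in H; lra.
have tot : \sum_S Pr P (E S) <= 1.
  have := @Pr_finU _ _ _ P _ xpredT E mE disj => /= <-.
  by apply: Pr_le1; exact: measurable_finU.
exists E; split => // S; apply: le_anti; rewrite lb andbT.
move: tot; rewrite -gibbs_prob_sum (bigD1 S) //= [leRHS](bigD1 S) //=.
have : \sum_(S' | S' != S) gibbs_prob S' <= \sum_(S' | S' != S) Pr P (E S').
  by apply: ler_sum.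
by lra.
Qed.

End FiniteVolume.

(** * Integrals of functions not known to be measurable *)

Section AeIntegral.
Import HBNNSimple.
Context {dd : measure_display} {T : measurableType dd} {R : realType}.
Variable mu : {measure set T -> \bar R}.
Local Open Scope ereal_scope.

(** The integral of a nonnegative function is a supremum over the simple functions below it, so
    monotonicity asks for no measurability. *)
Lemma ge0_le_integral_any (f g : T -> \bar R) : (forall x, 0 <= f x) ->
  (forall x, f x <= g x) -> \int[mu]_x f x <= \int[mu]_x g x.
Proof.
move=> f0 fg; rewrite !ge0_integralTE //; last by move=> x; exact: le_trans (fg x).
apply: le_ereal_sup => _ [h hf <-]; exists h => // x.
exact: le_trans (fg x).
Qed.

(* [f] need not be measurable, so this is not an instance of [ae_eq_integral] *)
Lemma ge0_integral_null_set (f g : T -> \bar R) (B : set T) : measurable B -> mu B = 0 ->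
  (forall x, 0 <= f x) -> (forall x, 0 <= g x) -> measurable_fun setT g ->
  (forall x, ~ B x -> f x = g x) -> \int[mu]_x f x = \int[mu]_x g x.
Proof.
move=> mB B0 f0 g0 mg fg; apply/eqP; rewrite eq_le; apply/andP; split.
  rewrite [leLHS]ge0_integralTE //; apply: ge_ereal_sup => _ [h hf <-].
  rewrite -integralT_nnsfun; apply: ae_ge0_le_integral => //.
  - by move=> x _; rewrite lee_fin; exact: fun_ge0.
  - exact/measurable_EFinP.
  exists B; split => // x /= nx; apply: contrapT => nB; apply: nx => _.
  by rewrite -fg //; exact: hf.
(* For the other bound, [g] cut to 0 on [B] lies below [f] everywhere. *)
rewrite [leLHS](_ : _ = \int[mu]_x (g \_ (~` B)) x).
  apply: ge0_le_integral_any => x; rewrite patchE; case: ifPn => // /set_mem nB.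
  by rewrite fg.
apply: ae_eq_integral => //.
  by apply/(measurable_restrictT _ _).1 => //; [exact: measurableC|exact: measurable_funTS].
exists B; split => // x /= nx; apply: contrapT => nB; apply: nx => _.
by rewrite patchE mem_set.
Qed.

Lemma integral_null_set (f g : T -> \bar R) (B : set T) : measurable B -> mu B = 0 ->
  measurable_fun setT g ->
  (forall x, ~ B x -> f x = g x) -> \int[mu]_x f x = \int[mu]_x g x.
Proof.
move=> mB B0 mg fg; rewrite integralE [RHS]integralE; congr (_ - _).
  apply: (ge0_integral_null_set mB B0) => //; first exact: measurable_funepos.
  by move=> x nB; rewrite !funeposE fg.
apply: (ge0_integral_null_set mB B0) => //; first exact: measurable_funeneg.
by move=> x nB; rewrite !funenegE fg.
Qed.

End AeIntegral.

(** * Cycles inside a finite set *)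

Section CyclesInside.
Context {d : nat}.

Lemma cyc_closed (g : pp_cyc d) x : pp_supp g x -> pp_supp g (g x).
Proof.
have [s [us s2 -> ->]] := cyc_seqP g; rewrite /= => xs.
by rewrite /pp_cyc_of_seq xs -(mem_rot 1) mem_nth // size_rot index_mem.
Qed.

(** A cycle inside [L] maps [L] into itself and is determined by its table of values on an
    enumeration of [L]. *)
Lemma finite_cycles (L : set (pp_site d)) : finite_set L ->
  finite_set [set g : pp_cyc d | pp_supp g `<=` L].
Proof.
move=> /finite_seqP[s sL].
pose phi (g : pp_cyc d) : {ffun 'I_(size s) -> 'I_(size s).+1} :=
  [ffun i => inord (index (g (tnth (in_tuple s) i)) s)].
have phiI : set_inj [set g : pp_cyc d | pp_supp g `<=` L] phi.
  move=> g g' /set_mem /= gL /set_mem /= g'L e; apply: cyc_inj; apply/funext => x.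
  have inL (k : pp_cyc d) y : pp_supp k `<=` L -> y \in s -> k y \in s.
    move=> kL ys; have [ky|ky] := pselect (k y = y); first by rewrite ky.
    have : L (k y) by apply/kL/cyc_closed.
    by rewrite sL.
  have [xs|xs] := boolP (x \in s); last first.
    have out (k : pp_cyc d) : pp_supp k `<=` L -> k x = x.
      move=> kL; apply: contrapT => kx; move/negP: xs; apply.
      by have : L x := kL x kx; rewrite sL.
    by rewrite !out.
  have /tnthP[i xE] : x \in in_tuple s by [].
  move: e => /ffunP/(_ i); rewrite !ffunE -xE => /(congr1 (@nat_of_ord _)).
  rewrite !inordK ?ltnS ?index_size // => e.
  by rewrite -(nth_index x (inL g x gL xs)) e nth_index // inL.
by rewrite -(eq_finite_set (inj_card_eq phiI)); exact: finite_finset.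
Qed.

Lemma cycles_enum (L : set (pp_site d)) : finite_set L ->
  exists n (c : 'I_n -> pp_cyc d), injective c /\
    forall g, pp_supp g `<=` L <-> exists i, g = c i.
Proof.
move=> /finite_cycles fC; set A := [set g | _] in fC.
pose s := finmap.enum_fset (fset_set A).
have us : uniq s := finmap.fset_uniq _.
exists (size s), (tnth (in_tuple s)); split; first exact: (tuple_uniqP (in_tuple s) us).
move=> g; transitivity (g \in s).
  by rewrite /s in_fset_set //; split => [h|/set_mem //]; exact: mem_set.
split => [/(@tnthP _ _ (in_tuple s))[i ->]|[i ->]]; first by exists i.
exact: (mem_tnth i (in_tuple s)).
Qed.

End CyclesInside.

(** * Gibbs expectations as finite sums *)

Section GibbsExpectation.
Context {R : realType} {d : nat}.
Variables (alpha : R) (V : pp_site d -> \bar R).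
Variables (n : nat) (c : 'I_n -> pp_cyc d) (L : set (pp_site d)).
Hypothesis c_inj : injective c.
Hypothesis c_range : forall g, pp_supp g `<=` L <-> exists i, g = c i.
Local Notation w := (fun g => weight alpha V (c g)).

Lemma fsbig_finType (T : Type) (idx : T) (op : Monoid.com_law idx) (I : finType) (Q : pred I)
  (F : I -> T) : \big[op/idx]_(i \in [set i | Q i]) F i = \big[op/idx]_(i | Q i) F i.
Proof.
have -> : [set i | Q i] = [set` enum Q].
  by apply/seteqP; split => i /=; rewrite mem_enum.
by rewrite -fsbig_seq ?enum_uniq // big_enum.
Qed.

Lemma image_bij : set_bij [set S : {set 'I_n} | compatible c S] (pp_admissible L)
  (fun S : {set 'I_n} => c @` [set` S]).
Proof.
split.
- move=> S /= cS; split => [_ [i _ <-]|_ _ [i iS <-] [j jS <-] ij]; first by apply/c_range; exists i.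
  apply/incE; move: cS => /forallP/(_ i); rewrite iS => /forallP/(_ j); rewrite jS /=.
  by move/implyP; apply; apply: contra_not_neq ij => ->.
- move=> S S' _ _ e; apply: (occupied_inj c_inj (R := R)) => g.
  by rewrite e.
- move=> A [AL AI]; exists [set i | `[< A (c i) >]]%SET.
    apply/forallP => i; rewrite inE; apply/implyP => /asboolP Ai.
    apply/forallP => j; rewrite inE; apply/implyP => /andP[/asboolP Aj ji].
    by apply/incE/AI => // /c_inj e; rewrite e eqxx in ji.
  apply/seteqP; split => g; first by move=> [i /=]; rewrite inE => /asboolP Ai <-.
  move=> Ag; have [i gi] := (c_range g).1 (AL g Ag).
  by exists i => //=; rewrite inE -gi; exact/asboolP.
Qed.

Lemma GZE (f : (pp_cyc d -> R) -> R) : pp_GZ alpha V L f =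
  \sum_(S | compatible c S) f (\1_(c @` [set` S])) * set_weight w S.
Proof.
rewrite /pp_GZ (reindex_fsbig _ _ _ _ image_bij) fsbig_finType.
apply: eq_bigr => S _; congr (_ * _); rewrite fsbig_image; last by move=> i j _ _ /c_inj.
exact: fsbig_finType.
Qed.

Lemma GEE (f : (pp_cyc d -> R) -> R) : pp_GE alpha V L f =
  \sum_S gibbs_prob alpha V c S * f (\1_(c @` [set` S])).
Proof.
rewrite /pp_GE !GZE [RHS](bigID (compatible c)) /= [X in _ + X]big1 ?addr0; last first.
  by move=> S nS; rewrite /gibbs_prob (negPf nS) mul0r.
rewrite mulr_suml; apply: eq_bigr => S cS; rewrite /gibbs_prob cS.
under [X in _ / X]eq_bigr do rewrite mul1r.
by rewrite -[LHS]mulrA [LHS]mulrC.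
Qed.

End GibbsExpectation.

(** * Infinite volume *)

Section FinvolFilter.
Context {d : nat}.

Lemma finvol_near (Q : set (pp_site d) -> Prop) (A : set (pp_site d)) : finite_set A ->
  (forall B, finite_set B -> A `<=` B -> Q B) -> @pp_finvol (pp_site d) Q.
Proof. by move=> fA AQ; exists A => // B [AB fB]; exact: AQ. Qed.

#[global] Instance finvol_filter : Filter (@pp_finvol (pp_site d)).
Proof.
apply: filter_from_filter; first by exists set0; exact: finite_set0.
move=> A B fA fB; exists (A `|` B); first by rewrite /= finite_setU.
by move=> C [ABC fC]; split; split => // x ?; apply: ABC; [left|right].
Qed.

(** Numbering the sites by [pickle] exhausts the lattice by a sequence of finite sets, which reduces
    limits along finite sets to limits of sequences. *)
Lemma finite_pickle (n : nat) : finite_set [set x : pp_site d | (choice.pickle x < n)%N].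
Proof.
apply: (@finite_preimage _ _ `I_n (@choice.pickle (pp_site d))); last exact: finite_II.
by move=> x y _ _; exact: (pcan_inj choice.pickleK).
Qed.

Lemma pickle_bound (A : set (pp_site d)) : finite_set A ->
  exists n0, forall x, A x -> (choice.pickle x < n0)%N.
Proof.
move=> /finite_seqP[s ->]; exists (\max_(x <- s) choice.pickle x).+1 => x /= xs.
by rewrite ltnS; exact: (leq_bigmax_seq (F := fun x => choice.pickle x) (P := xpredT)).
Qed.

End FinvolFilter.

Section Limit.
Context {R : realType} {d : nat} {dd : measure_display} {Om : measurableType dd}.
Variables (alpha : R) (V : pp_site d -> \bar R) (P : probability Om R).
Variable N : Om -> set (pp_gpoint R d).
Hypothesis alpha0 : 0 < alpha.
Hypothesis V0 : forall z, (0 <= V z)%E.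
Hypothesis NP : pp_is_PPP alpha V P N.
Hypothesis clans : {ae P, forall om, forall p : pp_gpoint R d,
  0 < pp_plife p -> finite_set (pp_clan (N om) p)}.
Variable t : R.

Lemma ae_eta_local : {ae P, forall om, forall g, exists2 A : set (pp_site d), finite_set A &
  forall B, A `<=` B -> pp_eta t (pp_restrict (N om) B) g = pp_eta t (N om) g}.
Proof.
have birth := ae_no_birth_at NP t.
move: clans; apply: filter_app; move: birth; apply: filterS => om nb fin g.
exact: eta_local.
Qed.

Definition field (om : Om) : {ptws pp_cyc d -> R} := fun g => fine (pp_eta t (N om) g).
Definition field_in (L : set (pp_site d)) (om : Om) : {ptws pp_cyc d -> R} :=
  fun g => fine (pp_eta t (pp_restrict (N om) L) g).

(** [G] is the simple function with the value of [f] at [S] on the event given by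
    [finite_volume_law]; these events cover all but a null set. The field itself is not known to be
    measurable. *)
Lemma finite_volume_expectation (L : set (pp_site d)) (f : {ptws pp_cyc d -> R} -> R) :
  finite_set L -> exists B (G : Om -> R), [/\ measurable B, Pr P B = 0, measurable_fun setT G,
    forall om, ~ B om -> G om = f (field_in L om) &
    (\int[P]_om (G om)%:E = (pp_GE alpha V L f)%:E)%E].
Proof.
move=> /cycles_enum[n [c [c_inj c_range]]].
have [E [mE PE dE etaE]] := finite_volume_law alpha0 V0 NP clans t c_inj c_range.
pose v (S : {set 'I_n}) : R := f (\1_(c @` [set` S])).
pose G (om : Om) : R := \sum_S v S * \1_(E S) om.
pose U := \bigcup_(S in [set S : {set 'I_n} | true]) E S.
have mU : measurable U by exact: measurable_finU.
have PU : Pr P U = 1.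
  rewrite (Pr_finU P xpredT mE dE); rewrite -(gibbs_prob_sum alpha0 V0 c).
  by apply: eq_bigr => S _; exact: PE.
exists (~` U), G; split.
- exact: measurableC.
- by rewrite Pr_setC // PU subrr.
- apply: measurable_sum => S; apply: measurable_funM => //; exact: measurable_indic.
- move=> om /contrapT[S _ ES]; rewrite /G (bigD1 S) //= big1 => [|S' ne].
    rewrite indicE mem_set // mulr1 addr0 /v; congr f; apply/funext => g.
    by rewrite /field_in (etaE S om ES).
  rewrite indicE memNset ?mulr0 // => ES'.
  by have : (E S' `&` E S) om by []; rewrite (dE _ _ ne).
- rewrite (GEE alpha V c_inj c_range).
  transitivity (\int[P]_om (\sum_S (v S)%:E * (\1_(E S) om)%:E))%E.
    by apply: eq_integral => om _; rewrite /G -sumEFin; apply: eq_bigr => S _; rewrite EFinM.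
  have ind S : P.-integrable setT (fun om => (\1_(E S) om : R)%:E).
    exact: integrable_indic.
  rewrite integral_sum //; last by move=> S; exact: integrableZl.
  rewrite -sumEFin; apply: eq_bigr => S _; rewrite integralZl //.
  rewrite integral_indic // setIT.
  transitivity ((v S)%:E * (Pr P (E S))%:E)%E; first by congr *%E; exact: PrE.
  by rewrite PE -EFinM mulrC.
Qed.

Lemma field_cvg om (L_ : (set (pp_site d))^nat) :
  (forall n, [set x | (choice.pickle x < n)%N] `<=` L_ n) ->
  (forall g, exists2 A : set (pp_site d), finite_set A &
     forall B, A `<=` B -> pp_eta t (pp_restrict (N om) B) g = pp_eta t (N om) g) ->
  (fun n => field_in (L_ n) om) @ \oo --> field om.
Proof.
move=> Lsub loc.
have pt g : field_in (L_ n) om g @[n --> \oo] --> field om g.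
  apply: cvg_near_cst.
  have [A fA AE] := loc g; have [n0 n0P] := pickle_bound fA.
  exists n0 => // n /= nn; rewrite /field_in /field AE // => x Ax; apply: Lsub => /=.
  exact: leq_trans (n0P x Ax) nn.
(* The pointwise topology is the supremum of the topologies induced by the evaluations. *)
apply/cvg_sup => g; rewrite cvg_image; last first.
  by rewrite eqEsubset; split=> v // _; exists (cst v).
move=> W /(pt g) /= near_W; exists (@^~ g @^-1` W) => //.
by rewrite eqEsubset; split => [r [k ? <-//]|r Wr]; exists (cst r).
Qed.

(** Dominated convergence gives the claim for every sequence of finite sets whose [n]-th term
    contains the first [n] sites; a failure along the filter would produce such a sequence staying
    at distance [e] from the limit. *)
Lemma GE_cvg (f : {ptws pp_cyc d -> R} -> R) :
  continuous f -> (exists M : R, forall c, `|f c| <= M) ->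
  (pp_GE alpha V L f)%:E @[L --> @pp_finvol (pp_site d)] -->
    (\int[P]_om (f (field om))%:E)%E.
Proof.
move=> cf [M fM].
have seq_cvg (L_ : (set (pp_site d))^nat) : (forall n, finite_set (L_ n)) ->
    (forall n, [set x | (choice.pickle x < n)%N] `<=` L_ n) ->
    (pp_GE alpha V (L_ n) f)%:E @[n --> \oo] --> (\int[P]_om (f (field om))%:E)%E /\
    (\int[P]_om (f (field om))%:E)%E \is a fin_num.
  move=> fL Lsub.
  have /choice[BG BGP] n : exists BG : set Om * (Om -> R), [/\ measurable BG.1, Pr P BG.1 = 0,
      measurable_fun setT BG.2, forall om, ~ BG.1 om -> BG.2 om = f (field_in (L_ n) om) &
      (\int[P]_om (BG.2 om)%:E = (pp_GE alpha V (L_ n) f)%:E)%E].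
    have [B [G H]] := finite_volume_expectation f (fL n); by exists (B, G).
  have [C [mC C0 Cloc]] := ae_measurable ae_eta_local.
  have null A : measurable A -> Pr P A = 0 -> P A = 0%E by move=> mA A0; rewrite PrE // A0.
  have [B [mB B0 BB]] : P.-negligible (C `|` \bigcup_n (BG n).1).
    apply: negligibleU; first by exists C; split => //; exact: null.
    apply: negligible_bigcup => n; have [m0 z0 _ _ _] := BGP n.
    by exists (BG n).1; split => //; exact: null.
  (* Cut to 0 on one null set [B], the functions are measurable and converge everywhere, so that
     their limit [F] is measurable. *)
  pose h n := (BG n).2 \_ (~` B).
  pose F := (fun om => f (field om)) \_ (~` B).
  have hE n om : ~ B om -> h n om = f (field_in (L_ n) om).
    move=> nB; rewrite /h patchE mem_set //; have [_ _ _ -> //] := BGP n.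
    by move=> Bn; apply: nB; apply: BB; right; exists n.
  have h0 n om : B om -> h n om = 0 by move=> Bo; rewrite /h patchE memNset.
  have FE om : ~ B om -> F om = f (field om) by move=> nB; rewrite /F patchE mem_set.
  have mh n : measurable_fun setT (h n).
    apply/(measurable_restrictT _ _).1; first exact: measurableC.
    by apply: measurable_funTS; have [] := BGP n.
  have hF om : h ^~ om @ \oo --> F om.
    have [Bo|nB] := pselect (B om).
      rewrite /F patchE memNset //; apply: cvg_near_cst; apply: nearW => n; exact: h0.
    rewrite FE //; under eq_fun do rewrite hE //.
    apply: (cvg_comp _ f (field_cvg Lsub _)); last exact: cf.
    by apply: Cloc => Co; apply: nB; apply: BB; left.
  have mF : measurable_fun setT F by apply: (measurable_fun_cvg mh) => om _; exact: hF.
  have M0 : 0 <= M by apply: le_trans (fM (fun=> 0)).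
  have hM n om : `|h n om| <= M.
    by have [/h0 ->|/hE ->] := pselect (B om); rewrite ?normr0.
  have [iF _ cvF] := @dominated_convergence _ _ _ P setT measurableT
    (fun n om => (h n om)%:E) (fun om => (F om)%:E) (fun=> M%:E)
    (fun n => (measurable_EFinP _ _).2 (mh n)) ((measurable_EFinP _ _).2 mF)
    (aeW P (fun om _ => cvg_comp _ EFin (hF om) (@cvg_id _ _)))
    (finite_measure_integrable_cst P M measurableT)
    (aeW P (fun om n _ => hM n om)).
  have FI : (\int[P]_om (f (field om))%:E = \int[P]_om (F om)%:E)%E.
    apply: (integral_null_set mB B0); first exact/measurable_EFinP.
    by move=> om nB; rewrite FE.
  rewrite FI; split; last exact: integrable_fin_num iF.
  rewrite (_ : (fun n => (pp_GE alpha V (L_ n) f)%:E) = (fun n => \int[P]_om (h n om)%:E)%E) //.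
  apply/funext => n; have [_ _ mG _ <-] := BGP n; apply/esym.
  apply: (integral_null_set mB B0); first exact/measurable_EFinP.
  by move=> om nB; rewrite /h patchE mem_set.
have box0 n : finite_set [set x : pp_site d | (choice.pickle x < n)%N] by exact: finite_pickle.
(* One concrete sequence shows that the limit is a real number. *)
have [_ fin] := seq_cvg _ box0 (fun n => @subset_refl _ _).
rewrite -(fineK fin); set l := fine _.
apply: cvg_EFin; first exact: nearW.
apply/cvgrPdist_lt => e e0; apply: contrapT => nnear.
have /choice[L_ L_P] n : exists B : set (pp_site d), [/\ finite_set B,
    [set x : pp_site d | (choice.pickle x < n)%N] `<=` B & e <= `|l - pp_GE alpha V B f|].
  apply: contrapT => nB; apply: nnear; apply: (finvol_near (box0 n)) => B fB nsub.
  by rewrite ltNge; apply/negP => eB; apply: nB; exists B.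
have [cv _] := seq_cvg L_ (fun n => let: And3 a _ _ := L_P n in a)
  (fun n => let: And3 _ a _ := L_P n in a).
rewrite -(fineK fin) in cv.
have [n0 _ n0P] := (cvgrPdist_lt _ _).1 (fine_cvg cv) e e0.
by have := n0P n0 (leqnn n0); have [_ _] := L_P n0; rewrite /= -/l leNgt => /negP.
Qed.

End Limit.

Theorem theorem3p3 (R : realType) (d : nat) (alpha : R) (V : pp_site d -> \bar R)
  (dd : measure_display) (Om : measurableType dd) (P : probability Om R)
  (N : Om -> set (pp_gpoint R d)) :
  0 < alpha ->
  pp_strictly_convex_potential V ->
  V 0 = 0%E ->
  pp_is_PPP alpha V P N ->
  {ae P, forall om, forall p : pp_gpoint R d, 0 < pp_plife p -> finite_set (pp_clan (N om) p)} ->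
  (forall (t : R) (g : pp_cyc d),
     {ae P, forall om,
        pp_eta t (pp_restrict (N om) L) g @[L --> @pp_finvol (pp_site d)] --> pp_eta t (N om) g})
  /\
  (forall (t : R) (f : {ptws pp_cyc d -> R} -> R),
     continuous f -> (exists M : R, forall c, `|f c| <= M) ->
     (pp_GE alpha V L f)%:E @[L --> @pp_finvol (pp_site d)] -->
       (\int[P]_om (f (fun g => fine (pp_eta t (N om) g)))%:E)%E).
Proof.
move=> alpha0 [V0 _] _ NP clans; split => [t g|t f cf bf]; last exact: GE_cvg.
have := ae_eta_local NP clans t; apply: filterS => om /(_ g)[A fA AE].
by apply: cvg_near_cst; apply: (finvol_near fA) => B _; exact: AE.
Qed.
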